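(* Let $G$ be a group which is hyperbolic relative to the peripheral subgroups $\mathcal{H}=\{H_i\}_{i\in I}$, with finite generating set $X$. Suppose that the Conjugacy Search Problem (CSP) in each peripheral subgroup can be bounded by a polynomial $\mathcal{P}$ of degree $n$. Then there is a polynomial $\mathcal{Q}$ of degree $2n+1$ such that for any two conjugate parabolic elements $a,b\in G$ there exists an element $x\in G$ with $x^{-1}ax=b$ and $\|x\|_X\le\mathcal{Q}(\mathcal{L})$, where $\mathcal{L}=\max\{\|a\|_X,\|b\|_X\}$.
   Context: Let $G$ be a finitely generated group with finite generating set $X$ and let $\mathcal{H}=\{H_i\}_{i\in I}$ be a set of subgroups of $G$ (the peripheral subgroups). $\|x\|_X$ is the word length of $x$ with respect to $X$. $\Gamma=\Gamma(G,X)$ is the Cayley graph with path metric $d_\Gamma$, and $\widehat{\Gamma}=\Gamma(G,X\cup\mathcal{H})$ is the coned-off Cayley graph, i.e. the Cayley graph of $G$ with respect to $X\cup\bigcup_{i}H_i$, with path metric $d_{\widehat\Gamma}$. Relative hyperbolicity (Farb): $G$ is weakly relatively hyperbolic with respect to $\mathcal{H}$ if $\widehat\Gamma$ is a hyperbolic metric space. A relative (quasi-)geodesic is a (quasi-)geodesic in $\widehat\Gamma$. An $H_i$-component of a path is a maximal subpath labelled by an element of $H_i$; a path penetrates a coset $gH_i$ if it has an $H_i$-component in that coset. Two $H_i$-components $s,t$ are connected if there is a path from the origin $s_-$ to the origin $t_-$ labelled by an element of $H_i$; a component of a single path is isolated if no distinct $H_i$-component of that path is connected to it; a path is without backtracking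 if all its $H_i$-components (for all $i$) are isolated. The Bounded Coset Penetration property (BCP) says: for any $\lambda$ there is a constant $c(\lambda)$ such that for any two relative $(\lambda,0)$-quasi-geodesics $p,q$ without backtracking with the same endpoints, (1) if both penetrate the same coset then they enter (and leave) it a $\Gamma$-distance at most $c(\lambda)$ apart; (2) if $p$ penetrates a coset $gH_i$ which $q$ does not penetrate, then $p$ travels a $\Gamma$-distance at most $c(\lambda)$ in $gH_i$. $G$ is hyperbolic relative to $\mathcal{H}$ if it is weakly relatively hyperbolic with respect to $\mathcal{H}$ and satisfies BCP. In this case $\mathcal{H}$ is finite and each $H_i$ is finitely generated. An element $g\in G$ is parabolic if it is conjugate in $G$ to some element of one of the peripheral subgroups $H_i$; otherwise it is hyperbolic. CSP bounds: the CSP in a finitely generated group $K$ (with a finite generating set and corresponding word length) is bounded by a function $f$ if for any $a,b\in K$ conjugate in $K$ there is $x\in K$ with $x^{-1}ax=b$ and with the length of $x$ at most $f(\max\{\text{length of }a,\text{length of }b\})$. *)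

(* Defs.v *)
From mathcomp Require Import all_boot all_order all_algebra.
From mathcomp Require Import all_classical all_reals.

Set Implicit Arguments.
Unset Strict Implicit.
Unset Printing Implicit Defensive.

Import Order.TTheory GRing.Theory Num.Theory.

Local Open Scope classical_set_scope.
Local Open Scope group_scope.

Section WordMetric.
Variable G : groupType.
Implicit Types (S K : set G) (g h x y : G) (w : seq G).

Definition is_subgroup K : Prop :=
  K 1 /\ forall x y, K x -> K y -> K (x * y^-1).

Definition is_word S w : Prop := forall x, x \in w -> S x \/ S x^-1.

Definition word_prod w : G := \prod_(x <- w) x.

Definition generates S K : Prop :=
  K = [set g | exists2 w, is_word S w & word_prod w = g].

Definition has_word S g (n : nat) : Prop :=
  exists w, [/\ is_word S w, word_prod w = g & size w = n].

(* Junk value 0 when [g] is not in the subgroup generated by [S]. *)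
Definition word_length S g : nat :=
  match pselect (exists n, `[< has_word S g n >]) with
  | left ex => ex_minn ex
  | right _ => 0%N
  end.

(* The path metric of the Cayley graph with respect to [S], whose edges join
   [g] to [g * x] for [x] in [S], on the set [G] of its vertices. *)
Definition cayley_dist S g h : nat := word_length S (g^-1 * h).

End WordMetric.

(* A combinatorial path in a Cayley graph: its origin and its label. *)
Record cayley_path (G : groupType) := CayleyPath { origin : G; label : seq G }.

Section Paths.
Variable G : groupType.
Implicit Types (S K : set G) (g : G) (p q : cayley_path G) (k l : nat).

Definition path_length p : nat := size (label p).

Definition vertex p k : G := origin p * word_prod (take k (label p)).

Definition terminus p : G := vertex p (path_length p).

Definition is_path S p : Prop := is_word S (label p).

Definition geodesic S p : Prop :=
  is_path S p /\ cayley_dist S (origin p) (terminus p) = path_length p.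

(* A pair [k], [l] of positions with [k <= l <= path_length p] stands for the
   subpath of [p] from [vertex p k] to [vertex p l]. *)
Definition labelled_in K p k l : Prop :=
  forall j, (k <= j < l)%N -> K (nth 1 (label p) j).

Definition component K p k l : Prop :=
  [/\ (k < l <= path_length p)%N, labelled_in K p k l
    & forall k' l', (k' <= k)%N -> (l <= l' <= path_length p)%N ->
        labelled_in K p k' l' -> k' = k /\ l' = l].

Definition connected K g h : Prop := K (g^-1 * h).

Definition isolated K p k l : Prop :=
  forall k' l', component K p k' l' ->
    connected K (vertex p k) (vertex p k') -> k' = k /\ l' = l.

Definition component_in_coset K g p k l : Prop :=
  component K p k l /\ K (g^-1 * vertex p k).

Definition penetrates K g p : Prop := exists k l, component_in_coset K g p k l.

End Paths.

Section RelativeHyperbolicity.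
Variables (R : realType) (G : groupType).

Local Open Scope ring_scope.

Definition quasi_geodesic (S : set G) (lambda c : R) (p : cayley_path G) : Prop :=
  is_path S p /\
  forall k l, (k <= l <= path_length p)%N ->
    (l - k)%:R <= lambda * (cayley_dist S (vertex p k) (vertex p l))%:R + c.

(* Rips' condition for the Cayley graph: a vertex of a side of a geodesic
   triangle is close to one of the other two sides. *)
Definition cayley_hyperbolic (S : set G) : Prop :=
  exists delta : R, forall p q r : cayley_path G,
    geodesic S p -> geodesic S q -> geodesic S r ->
    terminus p = origin q -> terminus q = terminus r -> origin p = origin r ->
    forall k, (k <= path_length p)%N ->
      (exists2 j, (j <= path_length q)%N &
         (cayley_dist S (vertex p k) (vertex q j))%:R <= delta) \/
      (exists2 j, (j <= path_length r)%N &
         (cayley_dist S (vertex p k) (vertex r j))%:R <= delta).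

Variables (I : Type) (X : set G) (H : I -> set G).

Definition relative_generators : set G := X `|` \bigcup_i H i.

Definition weakly_relatively_hyperbolic : Prop :=
  cayley_hyperbolic relative_generators.

Definition without_backtracking (p : cayley_path G) : Prop :=
  forall i k l, component (H i) p k l -> isolated (H i) p k l.

Definition bounded_coset_penetration : Prop :=
  forall lambda : R, exists c : R, forall p q : cayley_path G,
    quasi_geodesic relative_generators lambda 0 p ->
    quasi_geodesic relative_generators lambda 0 q ->
    without_backtracking p -> without_backtracking q ->
    origin p = origin q -> terminus p = terminus q ->
    (forall i g k l k' l',
       component_in_coset (H i) g p k l ->
       component_in_coset (H i) g q k' l' ->
       (cayley_dist X (vertex p k) (vertex q k'))%:R <= c /\
       (cayley_dist X (vertex p l) (vertex q l'))%:R <= c) /\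
    (forall i g k l,
       component_in_coset (H i) g p k l -> ~ penetrates (H i) g q ->
       (cayley_dist X (vertex p k) (vertex p l))%:R <= c).

Definition relatively_hyperbolic : Prop :=
  weakly_relatively_hyperbolic /\ bounded_coset_penetration.

Definition parabolic (a : G) : Prop :=
  exists i h g, H i h /\ a = (h ^ g)%g.

End RelativeHyperbolicity.

Arguments relatively_hyperbolic R {G I} X H.

(* In MathComp, [a ^ x] is [x^-1 * (a * x)]. *)
Definition csp_bounded (R : realType) (G : groupType) (K Y : set G)
    (f : R -> R) : Prop :=
  forall a b, K a -> K b -> (exists2 y, K y & (a ^ y)%g = b) ->
    exists x, [/\ K x, (a ^ x)%g = b
      & ((word_length Y x)%:R <=
         f (maxn (word_length Y a) (word_length Y b))%:R)%R].

(* Main.v *)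
Require Import Defs.
From mathcomp Require Import all_boot all_order all_algebra.
From mathcomp Require Import all_classical all_reals.
From mathcomp Require Import zify.

(** Only the second clause of BCP is used, and only for (2,0)-quasi-geodesics,
    which never backtrack. It makes the nearest-point projection to a peripheral
    coset [B] coarsely Lipschitz into the word metric of [X], as long as one does
    not move along [B]; thin triangles then bound the projection to [B] of every
    relative geodesic having no edge in [B].

    Projecting an [X]-path to [H i] shows that [H i] is generated, without
    distortion, by its elements of [X]-length at most a uniform constant. So there
    are finitely many distinct peripheral subgroups, and the comparison constants
    with their given generating sets are uniform.

    For a parabolic [a], choose [i] and [g] with [a ^ g] in [H i] and [g] of minimal
    relative length [D], and let [p] be a relative geodesic from 1 to [g]. By
    minimality [p] and its translate [a p] share no peripheral coset; hence they
    are close in the word metric far from their endpoints, and a pigeonhole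
    argument gives [D <= |a|_X + const]. Along an [X]-geodesic from 1 to [a], the
    projections to the components of [p] travel across them one component at a
    time, so the total [X]-length of the components, and with it [|g|_X], is
    linear in [|a|_X].

    This leaves [h] in [H i] and [k] in [H j] of linear length, conjugated by some
    [z]. Both cosets [H i] and [z H j] are stable under [h]. If they coincide, the
    CSP in [H i] applies. Otherwise the projection of one to the other conjugates
    [h], inside [H i], to a short element, and likewise [k] inside [H j]; finitely
    many pairs of short elements remain. The resulting bound has degree at most
    [max 1 n]. *)

Set Implicit Arguments.
Unset Strict Implicit.
Unset Printing Implicit Defensive.

Import Order.TTheory GRing.Theory Num.Theory.

(** * Word metrics *)

Section Words.
Local Open Scope group_scope.
Local Open Scope classical_set_scope.
Variables (G : groupType).
Implicit Types (S K : set G) (g h x y z : G) (m n : nat).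

Lemma has_word1 S : has_word S 1 0.
Proof. by exists [::]; rewrite /word_prod big_nil. Qed.

Lemma has_wordM S g h m n :
  has_word S g m -> has_word S h n -> has_word S (g * h) (m + n).
Proof.
move=> [v [Sv vg vm]] [w [Sw wh wn]]; exists (v ++ w); split.
- by move=> x; rewrite mem_cat => /orP[/Sv|/Sw].
- by rewrite /word_prod big_cat /= -vg -wh.
- by rewrite size_cat vm wn.
Qed.

Lemma has_word_letter S x : S x \/ S x^-1 -> has_word S x 1.
Proof.
by move=> Sx; exists [:: x]; rewrite /word_prod big_seq1; split=> // y /[!inE]/eqP->.
Qed.

Lemma has_wordV S g n : has_word S g n -> has_word S g^-1 n.
Proof.
move=> [w [Sw <- <-]]; elim: w Sw => [|x w IHw] Sw.
  by rewrite /word_prod big_nil invg1; exact: has_word1.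
rewrite /word_prod big_cons invgM /= -addn1; apply: has_wordM.
  by apply: IHw => y yw; apply: Sw; rewrite inE yw orbT.
by apply: has_word_letter; rewrite invgK or_comm; apply: Sw; rewrite mem_head.
Qed.

Lemma word_length_le S g n : has_word S g n -> word_length S g <= n.
Proof.
move=> gn; rewrite /word_length; case: pselect => // ex.
by case: ex_minnP => k _; apply; apply/asboolP.
Qed.

Lemma word_lengthP S K g :
  generates S K -> K g -> has_word S g (word_length S g).
Proof.
move=> -> [w Sw wg]; rewrite /word_length; case: pselect => [ex|[]].
  by case: ex_minnP => k /asboolP.
by exists (size w); apply/asboolP; exists w.
Qed.

Lemma word_length1 S : word_length S 1 = 0.
Proof. by apply/eqP; rewrite -leqn0; apply/word_length_le/has_word1. Qed.

Section Gen.
Variables (S K : set G).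
Hypothesis genS : generates S K.

Lemma word_lengthM g h : K g -> K h ->
  word_length S (g * h) <= word_length S g + word_length S h.
Proof.
move=> Kg Kh; apply: word_length_le.
by apply: has_wordM; apply: word_lengthP genS _.
Qed.

Lemma word_length_prefix g m n :
  has_word S g (m + n) -> exists h, has_word S h m /\ has_word S (h^-1 * g) n.
Proof.
move=> [w [Sw <- sw]]; exists (word_prod (take m w)); split.
  exists (take m w); split=> //; last by rewrite size_takel // sw leq_addr.
  by move=> x /mem_take/Sw.
exists (drop m w); split; first by move=> x /mem_drop/Sw.
  by rewrite -{3}(cat_take_drop m w) /word_prod big_cat /= mulKg.
by rewrite size_drop sw addKn.
Qed.

End Gen.
End Words.

(** * The metric of a Cayley graph, with paths as sequences of vertices *)

Section CayleyMetric.
Local Open Scope group_scope.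
Local Open Scope classical_set_scope.
Variables (G : groupType) (S : set G).
Hypothesis genS : generates S setT.
Implicit Types (x y z g : G) (f : nat -> G) (m n : nat).

Local Notation d := (cayley_dist S).

Lemma dist_xx x : d x x = 0.
Proof. by rewrite /cayley_dist mulVg word_length1. Qed.

Lemma dist_mull g x y : d (g * x) (g * y) = d x y.
Proof. by rewrite /cayley_dist invgM mulgA mulgVK. Qed.

Lemma dist_word x y : has_word S (x^-1 * y) (d x y).
Proof. exact: word_lengthP genS _. Qed.

Lemma dist_le x y n : has_word S (x^-1 * y) n -> d x y <= n.
Proof. exact: word_length_le. Qed.

Lemma dist_sym x y : d x y = d y x.
Proof.
apply/eqP; rewrite eqn_leq !dist_le //.
  by rewrite -[y^-1 * x]invgK invgM invgK; apply/has_wordV/dist_word.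
by rewrite -[x^-1 * y]invgK invgM invgK; apply/has_wordV/dist_word.
Qed.

Lemma dist_triangle y x z : d x z <= d x y + d y z.
Proof.
rewrite dist_le // -[x^-1](mulgK y) -mulgA.
by apply: has_wordM; exact: dist_word.
Qed.

Lemma dist_eq0 x y : d x y = 0 -> x = y.
Proof.
move=> d0; have := dist_word x y; rewrite d0 => -[w [_ + /size0nil w0]].
by rewrite w0 /word_prod big_nil => /esym/(congr1 (fun z => x * z)); rewrite mulVKg mulg1.
Qed.

Lemma dist_neq x y : x <> y -> 0 < d x y.
Proof. by move=> xy; rewrite lt0n; apply/eqP => /dist_eq0. Qed.

Lemma dist_letter x y : S (x^-1 * y) -> d x y <= 1.
Proof. by move=> Sxy; apply/dist_le/has_word_letter; left. Qed.

Lemma dist1_letter x y : d x y = 1%N -> S (x^-1 * y) \/ S (y^-1 * x).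
Proof.
move=> d1; have := dist_word x y; rewrite d1 => -[[|s [|t w]] [Sw wxy //]] _.
have:= Sw s (mem_head _ _); move: wxy; rewrite /word_prod big_seq1 => ->.
by rewrite invgM invgK.
Qed.

Definition geod f n := forall k l, k <= l <= n -> d (f k) (f l) = l - k.

Lemma geodP f n k l : geod f n -> k <= l -> l <= n -> d (f k) (f l) = l - k.
Proof. by move=> fn kl ln; apply: fn; rewrite kl. Qed.

Definition lip f n := forall k, k < n -> d (f k) (f k.+1) <= 1.

Lemma lip_dist f n k l : lip f n -> k <= l -> l <= n -> d (f k) (f l) <= l - k.
Proof.
move=> fn; elim: l => [|l IHl] kl ln.
  by move: kl; rewrite leqn0 => /eqP->; rewrite dist_xx.
case: (ltnP l k) => lk; first by rewrite (_ : k = l.+1) ?dist_xx //; lia.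
have := IHl lk (ltnW ln); have := fn l ln; have := dist_triangle (f l) (f k) (f l.+1).
lia.
Qed.

Lemma geod_lip f n : geod f n -> lip f n.
Proof. by move=> fn k kn; rewrite (geodP fn) //; lia. Qed.

Lemma lip_geod f n : lip f n -> n <= d (f 0) (f n) -> geod f n.
Proof.
move=> fl fd k l /andP[kl ln].
have := lip_dist fl (leq0n k) (leq_trans kl ln); have := lip_dist fl kl ln.
have := lip_dist fl ln (leqnn n).
have := dist_triangle (f k) (f 0) (f n); have := dist_triangle (f l) (f k) (f n).
lia.
Qed.

Lemma geod_exists x y : exists f, [/\ f 0 = x, f (d x y) = y & geod f (d x y)].
Proof.
have [w [Sw wxy sw]] := dist_word x y.
pose f k := x * word_prod (take k w).
have f0 : f 0 = x by rewrite /f take0 /word_prod big_nil mulg1.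
have fn : f (d x y) = y by rewrite /f -sw take_size wxy mulVKg.
exists f; split=> //; apply: lip_geod; last by rewrite f0 fn.
move=> k; rewrite -sw => kw; rewrite /f (take_nth 1) // /word_prod -cats1 big_cat /=.
rewrite big_seq1 dist_mull; apply/dist_le/has_word_letter.
by rewrite mulKg; apply/Sw/mem_nth.
Qed.

Lemma geod_sub f n k l : geod f n -> k <= l -> l <= n ->
  geod (fun j => f (k + j)) (l - k).
Proof. by move=> fn kl ln i j ij; rewrite (geodP fn); lia. Qed.

Lemma geod_rev f n : geod f n -> geod (fun j => f (n - j)) n.
Proof. by move=> fn i j ij; rewrite dist_sym (geodP fn); lia. Qed.

Lemma geod_mull g f n : geod f n -> geod (fun j => g * f j) n.
Proof. by move=> fn i j ij; rewrite dist_mull fn. Qed.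

Lemma geod_pick x y n : n <= d x y ->
  exists m : G, d x m = n /\ d m y = d x y - n.
Proof.
move=> nd; have [f [f0 fn fg]] := geod_exists x y.
exists (f n); split.
  by rewrite -[in LHS]f0 (geodP fg) // subn0.
by rewrite -[in LHS]fn (geodP fg).
Qed.

Definition concat f n h := fun j => if j <= n then f j else h (j - n).

Lemma lip_concat f n h m : lip f n -> lip h m -> f n = h 0 ->
  lip (concat f n h) (n + m).
Proof.
move=> fl hl fh k km; rewrite /concat; case: (ltngtP k n) => kn.
- by apply: fl; lia.
- by rewrite subSn ?hl //; lia.
- by rewrite kn fh subSn ?subnn ?hl //; lia.
Qed.

End CayleyMetric.

(** * Quasi-geodesics and bounded coset penetration *)

Section RelativeMetric.
Local Open Scope group_scope.
Local Open Scope classical_set_scope.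
Variables (G : groupType) (X : set G) (I : Type) (H : I -> set G).
Hypothesis genX : generates X setT.
Hypothesis subgrpH : forall i, is_subgroup (H i).
Implicit Types (x y z g : G) (f : nat -> G) (m n : nat) (i j : I).

Local Notation S := (relative_generators X H).
Local Notation d := (cayley_dist S).
Local Notation dX := (cayley_dist X).

Lemma subgroup1 i : H i 1.
Proof. by have [] := subgrpH i. Qed.

Lemma subgroupV i x : H i x -> H i x^-1.
Proof.
by move=> Hx; rewrite -[x^-1]mul1g; apply: (subgrpH i).2 => //; exact: subgroup1.
Qed.

Lemma subgroupM i x y : H i x -> H i y -> H i (x * y).
Proof.
by move=> Hx /subgroupV Hy; rewrite -[y]invgK; apply: (subgrpH i).2.
Qed.

Lemma coset_sym i x y : H i (x^-1 * y) -> H i (y^-1 * x).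
Proof. by move=> /subgroupV; rewrite invgM invgK. Qed.

Lemma coset_trans i y x z : H i (x^-1 * y) -> H i (y^-1 * z) -> H i (x^-1 * z).
Proof. by move=> xy /(subgroupM xy); rewrite -mulgA mulVKg. Qed.

Lemma coset_trans' i x y z : H i (x^-1 * y) -> H i (x^-1 * z) -> H i (y^-1 * z).
Proof. by move/coset_sym/coset_trans; apply. Qed.

Lemma gen_relative : generates S setT.
Proof.
apply/seteqP; split=> g // _.
have [w [Xw wg _]] := @word_lengthP _ _ _ g genX Logic.I.
by exists w => // x /Xw[] Xx; [left|right]; left.
Qed.
Let genS := gen_relative.

Lemma dist_coset i x y : H i (x^-1 * y) -> d x y <= 1.
Proof. by move=> Hxy; apply: dist_letter; right; exists i. Qed.

Lemma dist_relative_le x y : d x y <= dX x y.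
Proof.
apply: dist_le; have [w [Xw wg <-]] := dist_word genX x y.
by exists w; split=> // z /Xw[] Xz; [left|right]; left.
Qed.

Definition fpath f n := CayleyPath (f 0) (mkseq (fun k => (f k)^-1 * f k.+1) n).

Lemma fpath_length f n : path_length (fpath f n) = n.
Proof. exact: size_mkseq. Qed.

Lemma fpath_vertex f n k : k <= n -> vertex (fpath f n) k = f k.
Proof.
elim: k => [|k IHk] kn; rewrite /vertex /=.
  by rewrite take0 /word_prod big_nil mulg1.
rewrite (take_nth 1) ?size_mkseq // /word_prod -cats1 big_cat big_seq1 mulgA.
move: (IHk (ltnW kn)); rewrite /vertex /word_prod /= => ->.
by rewrite nth_mkseq // mulVKg.
Qed.

Lemma fpath_label f n k : k < n -> nth 1 (label (fpath f n)) k = (f k)^-1 * f k.+1.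
Proof. by move=> kn; rewrite nth_mkseq. Qed.

Lemma fpath_is_path f n : (forall k, k < n -> d (f k) (f k.+1) = 1%N) ->
  is_path S (fpath f n).
Proof.
move=> f1 _ /mapP[k] /[!mem_iota]/= kn ->.
by rewrite invgM invgK; apply/dist1_letter/f1.
Qed.

Lemma geod_fpath f n : geod S f n -> geodesic S (fpath f n).
Proof.
move=> fg; split; first by apply: fpath_is_path => k kn; rewrite fg //; lia.
by rewrite /terminus fpath_length fpath_vertex // (geodP fg) ?subn0.
Qed.

(** A [(2,0)]-quasi-geodesic. At consecutive indices the lower bound excludes zero steps, so every
    step is a genuine edge. *)
Definition qgeod f n :=
  lip S f n /\ forall k l, k <= l <= n -> l - k <= (2 * d (f k) (f l))%N.

Lemma qgeod_step f n k : qgeod f n -> k < n -> d (f k) (f k.+1) = 1%N.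
Proof. by move=> [fl fq] kn; have := fl k kn; have := fq k k.+1; lia. Qed.

Lemma qgeod_quasi (R : realType) f n :
  qgeod f n -> quasi_geodesic S (2 : R)%R 0%R (fpath f n).
Proof.
move=> fq; split; first by apply: fpath_is_path => k /(qgeod_step fq).
rewrite fpath_length => k l kl; rewrite addr0 -natrM ler_nat.
by rewrite !fpath_vertex; try lia; exact: fq.2.
Qed.

Lemma component_max_eq (K : set G) p k l l' :
  component K p k l -> component K p k l' -> l' = l.
Proof.
move=> [kl Kkl maxkl] [kl' Kkl' maxkl'].
case: (leqP l l') => ll'; first by case: (maxkl k l') => //; lia.
by case: (maxkl' k l) => //; lia.
Qed.

(** If [k < k'], then [f k] and [f k'.+1] lie in one coset, hence are at most 1 apart, and the
    factor 2 forces [k' = k.+1]. The edge at [k] then extends the second component to the left,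
    against maximality. *)
Lemma qgeod_component_le i f n k l k' l' : qgeod f n ->
  component (H i) (fpath f n) k l -> component (H i) (fpath f n) k' l' ->
  k <= k' -> H i ((f k)^-1 * f k') -> k' = k.
Proof.
move=> fq [/[!fpath_length] kl Kkl _] [/[!fpath_length] kl' Kkl' max'] kk' Hkk'.
have Hk : H i ((f k)^-1 * f k.+1).
  by rewrite -(@fpath_label f n); [apply: Kkl|]; lia.
have Hk' : H i ((f k')^-1 * f k'.+1).
  by rewrite -(@fpath_label f n); [apply: Kkl'|]; lia.
case: (ltngtP k k') => [{}kk'|//|//]; last by lia.
have dk : d (f k) (f k'.+1) <= 1 by exact: dist_coset (coset_trans Hkk' Hk').
have qk : k'.+1 - k <= (2 * d (f k) (f k'.+1))%N by apply: fq.2; lia.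
have k'E : k' = k.+1 by lia.
case: (max' k l') => //; try lia.
move=> m km; rewrite fpath_label; last lia.
have [<-//|/eqP mk] := eqVneq k m.
by rewrite -(@fpath_label f n); [apply: Kkl'|]; lia.
Qed.

Lemma qgeod_without_backtracking f n :
  qgeod f n -> without_backtracking H (fpath f n).
Proof.
move=> fq i k l comp k' l' comp'; rewrite /connected.
have [kl _ _] := comp; have [kl' _ _] := comp'; rewrite fpath_length in kl kl'.
rewrite !fpath_vertex; try lia; move=> Hkk'.
have kE : k' = k.
  case: (leqP k k') => kk'; first exact: qgeod_component_le comp comp' kk' Hkk'.
  by apply/esym/(qgeod_component_le fq comp' comp); [lia|exact: coset_sym].
by subst k'; split=> //; apply: component_max_eq comp comp'.
Qed.

(** The second clause of BCP for a component that is exactly the first edge of [f]. The path [f']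
    may visit vertices of the coset, as long as it has no edge there. *)
Definition first_edge_bounded (C : nat) := forall f n f' n' i,
  qgeod f n -> qgeod f' n' -> f 0 = f' 0 -> f n = f' n' -> 0 < n ->
  H i ((f 0)^-1 * f 1%N) -> (1 < n -> ~ H i ((f 1%N)^-1 * f 2)) ->
  (forall m, m < n' -> H i ((f 0)^-1 * f' m) -> ~ H i ((f 0)^-1 * f' m.+1)) ->
  dX (f 0) (f 1%N) <= C.

Lemma bcp_first_edge (R : realType) :
  bounded_coset_penetration R X H -> exists C, first_edge_bounded C.
Proof.
move=> /(_ 2%R)[c bcp]; exists (Num.bound `|c|%R).
move=> f n f' n' i fq fq' f0 fn n0 H01 H12 offB.
have ft : terminus (fpath f n) = terminus (fpath f' n').
  by rewrite /terminus !fpath_length !fpath_vertex.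
have [_] := bcp _ _ (qgeod_quasi R fq) (qgeod_quasi R fq')
  (qgeod_without_backtracking fq) (qgeod_without_backtracking fq') f0 ft.
move=> /(_ i (f 0) 0 1%N); rewrite !fpath_vertex // => le_c.
rewrite -(ler_nat R) (le_trans (le_c _ _)) //.
- split; last by rewrite fpath_vertex // mulVg; exact: subgroup1.
  split; first by rewrite fpath_length.
    by case=> // _; rewrite fpath_label.
  move=> k' l'; rewrite leqn0 fpath_length => /eqP-> l'1 lab; split=> //.
  apply/eqP; rewrite eqn_leq (andP l'1).1 andbT leqNgt; apply/negP => l'2.
  have := lab 1%N; rewrite fpath_label; last lia.
  by move=> lab1; apply: H12 => //; [lia|apply: lab1; lia].
- move=> [k [l [[/[!fpath_length] kl Kkl _]]]]; rewrite fpath_vertex; last lia.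
  move=> Hk; apply: (offB k) => //; first lia.
  apply: coset_trans Hk _; rewrite -(@fpath_label f' n'); last lia.
  by apply: Kkl; lia.
- by rewrite (le_trans (ler_norm _)) // ltW // archi_boundP // normr_ge0.
Qed.

End RelativeMetric.

(** * Projections to peripheral cosets *)

Section Projections.
Local Open Scope group_scope.
Local Open Scope classical_set_scope.
Variables (G : groupType) (X : set G) (I : Type) (H : I -> set G).
Hypothesis genX : generates X setT.
Hypothesis subgrpH : forall i, is_subgroup (H i).
Variable C : nat.
Hypothesis bcpC : first_edge_bounded X H C.
Implicit Types (x y z g m v w : G) (f : nat -> G) (n : nat) (i j : I) (A : set G).

Local Notation S := (relative_generators X H).
Local Notation d := (cayley_dist S).
Local Notation dX := (cayley_dist X).
Let genS : generates S setT := gen_relative H genX.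
Let triS := dist_triangle genS.
Let triX := dist_triangle genX.

Definition coset i g : set G := [set x | H i (g^-1 * x)].

Definition nearest A v x := A x /\ forall y, A y -> d v x <= d v y.

Definition avoids f n A := forall k, k < n -> A (f k) -> ~ A (f k.+1).

Lemma coset_refl i g : coset i g g.
Proof. by rewrite /coset /= mulVg; exact: subgroup1. Qed.

Lemma coset_mem i g x y : coset i g x -> coset i g y -> H i (x^-1 * y).
Proof. exact: coset_trans'. Qed.

Lemma coset_memr i g x y : coset i g x -> H i (x^-1 * y) -> coset i g y.
Proof. exact: coset_trans. Qed.

Lemma cosetE i g x : coset i g x -> coset i g = coset i x.
Proof.
move=> gx; apply/seteqP; split=> y; first exact: coset_mem.
exact: coset_memr.
Qed.

Lemma coset_diam i g x y : coset i g x -> coset i g y -> d x y <= 1.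
Proof. by move=> gx gy; apply/dist_coset/coset_mem/gy. Qed.

Lemma nearest_exists A v x : A x -> exists y, nearest A v y.
Proof.
move=> Ax; have ex : exists n, `[< exists2 y, A y & d v y = n >].
  by exists (d v x); apply/asboolP; exists x.
have /ex_minnP[n /asboolP[y Ay yn] min] := ex.
exists y; split=> // z Az; rewrite yn; apply: min.
by apply/asboolP; exists z.
Qed.

Lemma nearest_coset i g v : exists y, nearest (coset i g) v y.
Proof. exact: nearest_exists (coset_refl i g). Qed.

Lemma nearest_self A v x : A v -> nearest A v x -> x = v.
Proof.
move=> Av [_ /(_ v Av)]; rewrite dist_xx leqn0 => /eqP/(dist_eq0 genS).
by [].
Qed.

Lemma nearest_refl A v : A v -> nearest A v v.
Proof. by move=> Av; split=> // y _; rewrite dist_xx. Qed.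

Lemma nearest_between A v m x :
  nearest A v x -> d v m + d m x = d v x -> nearest A m x.
Proof.
by move=> [Ax vx] vmx; split=> // y /vx; have := triS m v y; lia.
Qed.

Lemma nearest_mull i g u v x :
  nearest (coset i g) v x -> nearest (coset i (u * g)) (u * v) (u * x).
Proof.
move=> [gx vx]; split; first by rewrite /coset /= invgM mulgA mulgVK.
move=> y uy; rewrite dist_mull -[y](mulVKg u) dist_mull; apply: vx.
by rewrite /coset /= mulgA -invgM.
Qed.

(** Two paths from [x] to [v'] are compared: [p] crosses the coset to [x'] and follows a geodesic,
    [q] follows a geodesic to [v] and takes the edge to [v']. Minimality of the projections makes
    both [(2,0)]-quasi-geodesics, with [d v x <= d v' x'] serving for [q], and [q] has no edge in
    the coset. *)
Lemma nearest_edge_le i g v v' x x' :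
  d v v' <= 1 -> ~ (coset i g v /\ coset i g v') -> d v x <= d v' x' ->
  nearest (coset i g) v x -> nearest (coset i g) v' x' -> dX x x' <= C.
Proof.
set A := coset i g => vv' nA le_d [Ax vx] [Ax' vx'].
have [<-|/eqP xx'] := eqVneq x x'; first by rewrite dist_xx.
have [f [f0 fn fg]] := geod_exists genS x' v'.
have [h [h0 hn hg]] := geod_exists genS x v.
set D' := d x' v' in fn fg; set D := d x v in hn hg.
have DE : d v x = D by exact: dist_sym.
have D'E : d v' x' = D' by exact: dist_sym.
pose p k := if k is k'.+1 then f k' else x.
pose e k := if k is k'.+1 then v' else v.
pose q := concat h D e; set D2 := D + d v v'.
have hd k : k <= D -> d v (h k) = D - k.
  by move=> kD; rewrite dist_sym // -{1}hn (geodP hg).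
have fd k : k <= D' -> d v' (f k) = D' - k.
  by move=> kD; rewrite dist_sym // -{1}fn (geodP fg).
have hA k : k < D -> ~ A (h k.+1) by move=> kD /vx; rewrite hd // DE; lia.
have fA : 0 < D' -> ~ A (f 1%N) by move=> D'0 /vx'; rewrite fd // D'E; lia.
have lq : lip S q D2.
  apply: lip_concat; [exact: geod_lip| |by rewrite hn].
  by move=> k kv; have -> : k = 0 by lia.
have qn : q D2 = v'.
  rewrite /q /concat /D2; have [vv'E|dvv'] : d v v' = 0 \/ d v v' = 1%N by lia.
    by rewrite vv'E addn0 leqnn hn (dist_eq0 genS vv'E).
  by rewrite dvv' ifN ?addKn //; lia.
have [p1 pn] : p 1%N = x' /\ p D'.+1 = v' by [].
rewrite -p1; have -> : x = p 0 by [].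
apply: (bcpC (f := p) (n := D'.+1) (f' := q) (n' := D2) (i := i)).
- split; first by case=> [|k] kD; 
    [rewrite /= f0; exact: coset_diam Ax Ax'|exact: (geod_lip fg)].
  move=> [|k] [|l] kl //.
    have := vx' x Ax; have := triS (f l) v' x; have := dist_neq genS xx'.
    rewrite fd ?D'E // [d (f l) x]dist_sym //=.
    by case: l kl => [|l] kl; [rewrite f0; lia|lia].
  by rewrite /= (geodP fg) //; lia.
- split=> // k l /andP[kl lD]; case: (leqP l D) => lD'.
    by rewrite /q /concat lD' (leq_trans kl lD') (geodP hg) //; lia.
  have lE : l = D2 by lia.
  case: (leqP k D) => kD; last first.
    by have -> : k = l; rewrite ?subnn; lia.
  rewrite lE qn /q /concat kD.
  have [->|/eqP kD'] := eqVneq k D; first by rewrite hn; lia.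
  have := vx' x Ax; have := triS (h k) v' x.
  have -> : d (h k) x = k by rewrite dist_sym // -{1}h0 (geodP hg) ?subn0.
  by rewrite [d v' (h k)]dist_sym // D'E; lia.
- by rewrite /q /concat.
- by rewrite qn pn.
- by [].
- by rewrite p1; exact: coset_mem Ax Ax'.
- rewrite p1 [p 2]/= => D'0 Hf; apply: fA; first lia.
  exact: coset_memr Ax' Hf.
move=> k kD /(coset_memr Ax) Aqk /(coset_memr Ax); move: Aqk.
rewrite /q /concat; case: (ltngtP k D) => kD'.
- by move=> _; exact: hA.
- by have : k < D2 by []; rewrite /D2; lia.
- by rewrite kD' hn subSnn => Av Av'; apply: nA.
Qed.

Lemma nearest_edge i g v v' x x' :
  d v v' <= 1 -> ~ (coset i g v /\ coset i g v') ->
  nearest (coset i g) v x -> nearest (coset i g) v' x' -> dX x x' <= C.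
Proof.
move=> vv' nA vx vx'; case: (leqP (d v x) (d v' x')) => dd.
  exact: nearest_edge_le vv' nA dd vx vx'.
rewrite dist_sym //; apply: nearest_edge_le (ltnW dd) vx' vx.
  by rewrite dist_sym.
by rewrite and_comm.
Qed.

(** For [t] in [H j] outside [H i], the path [1, s, s * t] and the single edge from [1] to [s * t],
    labelled in [H j], have the same ends, and only the former has an edge in the coset [H i]. *)
Lemma intersection_bounded_sub i j s :
  H i s -> H j s -> ~ (H j `<=` H i) -> dX 1 s <= C.
Proof.
move=> Hi Hj /existsNP[t] /not_implyP[Hjt Hit].
have [->|/eqP s1] := eqVneq s 1; first by rewrite dist_xx.
have Hist : ~ H i (s * t).
  move=> Hist; apply: Hit; rewrite -[t](mulKg s).
  by apply: subgroupM Hist => //; exact: subgroupV.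
pose p k := if k is k'.+1 then (if k' is _.+1 then s * t else s) else 1.
pose q k := if k is _.+1 then s * t else 1.
have d1 u : H i u -> d 1 u <= 1
  by move=> Hu; apply: (dist_coset X (i := i)); rewrite invg1 mul1g.
have d1' u : H j u -> d 1 u <= 1
  by move=> Hu; apply: (dist_coset X (i := j)); rewrite invg1 mul1g.
have dst : d 1 (s * t) = 1%N.
  apply/eqP; rewrite eqn_leq (d1' _ (subgroupM subgrpH Hj Hjt)) dist_neq // => st1.
  by apply: Hist; rewrite -st1; exact: subgroup1.
have dst' : d s (s * t) = 1%N.
  rewrite -[X in d X _](mulg1 s) dist_mull; apply/eqP.
  rewrite eqn_leq (d1' _ Hjt) dist_neq // => t1.
  by apply: Hit; rewrite -t1; exact: subgroup1.
have ds : d 1 s = 1%N.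
  by apply/eqP; rewrite eqn_leq d1 // dist_neq //; exact/nesym.
apply: (bcpC (f := p) (n := 2) (f' := q) (n' := 1%N) (i := i)) => //=.
- split; first by case=> [|[|k]] //=; lia.
  by move=> [|[|[|k]]] [|[|[|l]]] //=; lia.
- split; first by case=> [|k] //=; lia.
  by move=> [|[|k]] [|[|l]] //=; lia.
- by rewrite invg1 mul1g.
- by rewrite mulKg.
- by case=> //= _ _; rewrite invg1 mul1g.
Qed.

Lemma intersection_bounded i j s : H i s -> H j s -> H i <> H j -> dX 1 s <= C.
Proof.
move=> Hi Hj ij; have [ji|] := pselect (H j `<=` H i); last first.
  exact: intersection_bounded_sub.
apply: intersection_bounded_sub Hj Hi _ => ij'.
by apply: ij; apply/seteqP; split.
Qed.

(** If [v] and [v'] both lie in the first coset too, they differ by an element of [H i] and [H j],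
    which are distinct since the cosets meet but differ. Otherwise [nearest_edge] applies. *)
Lemma nearest_same_coset i g j h v v' x x' :
  coset i g <> coset j h -> coset j h v -> coset j h v' ->
  nearest (coset i g) v x -> nearest (coset i g) v' x' -> dX x x' <= C.
Proof.
move=> AB Bv Bv' vx vx'.
have [[Av Av']|nA] := pselect (coset i g v /\ coset i g v'); last first.
  by apply: nearest_edge vx vx' => //; exact: coset_diam Bv Bv'.
rewrite (nearest_self Av vx) (nearest_self Av' vx').
rewrite -[v]mulg1 -{1}[v'](mulVKg v) dist_mull.
apply: (@intersection_bounded i j); [exact: coset_mem Av Av'|exact: coset_mem Bv Bv'|].
by move=> ij; apply: AB; rewrite (cosetE Av) (cosetE Bv) /coset ij.
Qed.

(** One [C] per edge, and one more because a single vertex may already have several nearest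
    points. *)
Lemma nearest_path i g f n x x' :
  lip S f n -> avoids f n (coset i g) ->
  nearest (coset i g) (f 0) x -> nearest (coset i g) (f n) x' ->
  dX x x' <= (n.+1 * C)%N.
Proof.
move=> + + xn; elim: n x' => [|n IHn] x' fl fA xn'.
  have [A0|A0] := pselect (coset i g (f 0)).
    by rewrite (nearest_self A0 xn) (nearest_self A0 xn') dist_xx.
  by rewrite mul1n; apply: nearest_edge xn xn' => [|[]//]; rewrite dist_xx.
have [y yn] := nearest_coset i g (f n).
have le1 : dX x y <= (n.+1 * C)%N.
  by apply: IHn yn => k kn; [apply: fl|apply: fA]; lia.
have le2 : dX y x' <= C.
  apply: nearest_edge yn xn'; first exact: fl.
  by move=> [An]; exact: fA.
by have := triX y x x'; rewrite mulSn; lia.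
Qed.

Lemma nearest_step i g v v' x x' : dX v v' <= 1 ->
  nearest (coset i g) v x -> nearest (coset i g) v' x' -> dX x x' <= C.+1.
Proof.
move=> vv' vx vx'.
have [[Av Av']|nA] := pselect (coset i g v /\ coset i g v').
  by rewrite (nearest_self Av vx) (nearest_self Av' vx') (leq_trans vv').
apply: leqW; apply: nearest_edge nA vx vx'.
by apply: leq_trans vv'; exact: dist_relative_le.
Qed.

Lemma nearest_far i g v v' x x' N :
  d v v' <= N -> N < d v x ->
  nearest (coset i g) v x -> nearest (coset i g) v' x' -> dX x x' <= (N.+1 * C)%N.
Proof.
move=> vv' Nx vx vx'; have [f [f0 fn fg]] := geod_exists genS v v'.
have : dX x x' <= ((d v v').+1 * C)%N.
  apply: (@nearest_path i g f); rewrite ?f0 ?fn //; first exact: geod_lip.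
  by move=> k kn /vx.2 + _; rewrite -{2}f0 (geodP fg) //; lia.
by move=> /leq_trans; apply; rewrite leq_mul2r; lia.
Qed.

(** * Thin triangles and projections of geodesics *)

Definition thin_triangles (delta : nat) := forall x y z m f n,
  d x m + d m y = d x y -> geod S f n -> f 0 = x -> f n = z ->
  (exists m', d y m' + d m' z = d y z /\ d m m' <= delta) \/
  (exists2 k, k <= n & d m (f k) <= delta).

(** The sides through [m] and from [y] to [z] are given by distances alone, since geodesics can be
    chosen on them; the third side must be the prescribed [f], whose vertices are projected
    later. *)
Lemma rips_thin (R : realType) :
  weakly_relatively_hyperbolic R X H -> exists delta, thin_triangles delta.
Proof.
move=> [c rips]; exists (Num.bound `|c|%R) => x y z m f n xmy fg f0 fn.
have toN u v : ((d u v)%:R <= c)%R -> d u v <= Num.bound `|c|%R.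
  rewrite -(ler_nat R) => /le_trans; apply.
  by rewrite (le_trans (ler_norm _)) // ltW // archi_boundP // normr_ge0.
have [h [h0 hn hg]] := geod_exists genS x m.
have [h' [h0' hn' hg']] := geod_exists genS m y.
have [e [e0 en eg]] := geod_exists genS y z.
pose p := concat h (d x m) h'.
have p0 : p 0 = x by rewrite /p /concat.
have pn : p (d x m + d m y) = y.
  rewrite /p /concat addKn; case: ifP => // le0.
  have /(dist_eq0 genS) <- : d m y = 0 by lia.
  by rewrite (_ : d x m + _ = d x m) // dist_xx addn0.
have pg : geod S p (d x m + d m y).
  apply: lip_geod => //; last by rewrite p0 pn xmy.
  by apply: lip_concat; rewrite ?hn ?h0' //; exact: geod_lip.
have := rips _ _ _ (geod_fpath genX pg) (geod_fpath genX eg) (geod_fpath genX fg).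
rewrite /terminus !fpath_length !fpath_vertex //= pn e0 en fn p0 f0.
move=> /(_ erefl erefl erefl (d x m) (leq_addr _ _)).
rewrite fpath_vertex ?leq_addr // (_ : p (d x m) = m); last by rewrite /p /concat leqnn.
case=> -[k kn]; rewrite fpath_vertex // => /toN mk; last by right; exists k.
left; exists (e k); split=> //.
by have := geodP eg (leq0n k) kn; have := geodP eg kn (leqnn _); rewrite e0 en; lia.
Qed.

Variable delta : nat.
Hypothesis thinS : thin_triangles delta.

(** Unless [f 0] is close to the coset, take [m] at distance [T] from [x] on the way there and use
    the two triangles of the quadrilateral [f 0], [x], [z], [f n]. Closeness to [f] gives the second
    alternative, closeness to the side from [f n] to [z] the first. The side from [x] to [z] lies in
    the coset, out of reach because [T > 2 * delta]. *)
Lemma bounded_image_end i g f n x z (T := (2 * delta).+2) :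
  geod S f n -> nearest (coset i g) (f 0) x -> nearest (coset i g) (f n) z ->
  dX x z <= ((2 * delta).+1 * C)%N \/
  exists k y, [/\ k <= n, nearest (coset i g) (f k) y,
     dX x y <= (delta.+1 * C)%N & d (f k) y <= T + delta].
Proof.
set A := coset i g => fg xn zn.
case: (leqP (d (f 0) x) T) => dT.
  by right; exists 0, x; split=> //; [rewrite dist_xx|lia].
have [m [d0m dmx]] : exists m,
    d (f 0) m = d (f 0) x - T /\ d m x = d (f 0) x - (d (f 0) x - T).
  by apply: geod_pick => //; lia.
have {}dmx : d m x = T by lia.
have mn : nearest A m x by apply: nearest_between xn _; lia.
have farA y : A y -> T <= d m y by move=> /mn.2; rewrite dmx.
have xmx : d (f 0) m + d m x = d (f 0) x by lia.
have [[m1 [m1b dm1]]|[k kn dmk]] := thinS xmx fg erefl erefl; last first.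
  have [y yn] := nearest_coset i g (f k).
  right; exists k, y; split=> //; first by apply: nearest_far dmk _ mn yn; lia.
  have := yn.2 x xn.1; have := triS m (f k) x.
  by rewrite [d (f k) m]dist_sym //; lia.
have [h [h0 hn hg]] := geod_exists genS x z.
have [[m2 [m2b dm2]]|[k kn' d1k]] := thinS m1b hg h0 hn.
  have dmm2 : d m m2 <= 2 * delta by have := triS m1 m m2; lia.
  left; apply: nearest_far dmm2 _ mn _; first by lia.
  exact: nearest_between zn m2b.
have xz := coset_diam xn.1 zn.1.
have : A (h k).
  have [->|kE] : k = 0 \/ k = d x z by lia.
    by rewrite h0; exact: xn.1.
  by rewrite kE hn; exact: zn.1.
by move=> /farA; have := triS m1 m (h k); lia.
Qed.

Definition image_bound := ((8 * delta + 8) * C)%N.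

(** [bounded_image_end] is applied from both ends. Either it settles the claim, or the two vertices
    found are within [3 * delta + 2] of the coset, hence at most [6 * delta + 5] apart along [f],
    and [nearest_path] covers the stretch between them. *)
Lemma bounded_image i g f n x z :
  geod S f n -> avoids f n (coset i g) ->
  nearest (coset i g) (f 0) x -> nearest (coset i g) (f n) z ->
  dX x z <= image_bound.
Proof.
move=> fg fA xn zn; rewrite /image_bound.
have [|[k [y [kn yn xy fy]]]] := bounded_image_end fg xn zn.
  by move=> /leq_trans; apply; rewrite leq_mul2r; lia.
have zn' : nearest (coset i g) (f (n - 0)) z by rewrite subn0.
have xn' : nearest (coset i g) (f (n - n)) x by rewrite subnn.
have [|[k' [y' [kn' yn' zy' fy']]]] := bounded_image_end (geod_rev genS fg) zn' xn'.
  by rewrite dist_sym // => /leq_trans; apply; rewrite leq_mul2r; lia.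
set l := n - k' in yn' fy'.
have main a b u v : a <= b -> b <= n ->
    nearest (coset i g) (f a) u -> nearest (coset i g) (f b) v ->
    d (f a) u <= (2 * delta).+2 + delta -> d (f b) v <= (2 * delta).+2 + delta ->
    dX u v <= ((6 * delta + 6) * C)%N.
  move=> ab bn an vn au bv.
  have : dX u v <= ((b - a).+1 * C)%N.
    apply: (@nearest_path i g (fun k => f (a + k))).
    - exact: geod_lip (geod_sub fg ab bn).
    - by move=> j jb; rewrite addnS; apply: fA; lia.
    - by rewrite addn0.
    - by rewrite subnKC.
  move=> /leq_trans; apply; rewrite leq_mul2r.
  have := coset_diam an.1 vn.1; have := triS u (f a) (f b); have := triS v u (f b).
  by rewrite (geodP fg) // [d v (f b)]dist_sym //; lia.
have yy' : dX y y' <= ((6 * delta + 6) * C)%N.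
  case: (leqP k l) => kl; first by apply: main yn yn' fy fy' => //; lia.
  by rewrite dist_sym //; apply: main yn' yn fy' fy => //; lia.
have := triX y x z; have := triX y' y z; rewrite [dX y' z]dist_sym //.
by move: xy zy' yy'; rewrite !mulnDl mulSn; lia.
Qed.

Lemma coset_geod i g f n k l : geod S f n -> k <= l -> l <= n ->
  coset i g (f k) -> coset i g (f l) -> l <= k.+1.
Proof. by move=> fg kl ln /coset_diam h /h; rewrite (geodP fg) //; lia. Qed.

Lemma edge_cases v v' : d v v' <= 1 -> dX v v' <= 1 \/ exists j, H j (v^-1 * v').
Proof.
move=> vv'; have [/(dist_eq0 genS) ->|d1] : d v v' = 0 \/ d v v' = 1%N by lia.
  by left; rewrite dist_xx.
have [[Xv|[j _ Hj]]|[Xv|[j _ Hj]]] := dist1_letter genS d1.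
- by left; exact: dist_letter.
- by right; exists j.
- by left; rewrite dist_sym //; exact: dist_letter.
- by right; exists j; exact: coset_sym.
Qed.

Lemma dist_path f n N : (forall k, k < n -> dX (f k) (f k.+1) <= N) ->
  dX (f 0) (f n) <= (n * N)%N.
Proof.
elim: n => [|n IHn] fN; first by rewrite dist_xx.
have := triX (f n) (f 0) (f n.+1); have := fN n (ltnSn n).
have : dX (f 0) (f n) <= (n * N)%N by apply: IHn => k kn; apply: fN; lia.
by rewrite mulSn; lia.
Qed.

(** * Relatively shortest conjugators into a peripheral subgroup *)

Section MinimalConjugator.
Variables (a : G) (i0 : I) (g : G) (p : nat -> G) (D : nat).
Hypothesis Hag : H i0 (a ^ g).
Hypothesis minD : forall j g', H j (a ^ g') -> D <= d 1 g'.
Hypothesis p0 : p 0 = 1.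
Hypothesis pD : p D = g.
Hypothesis pg : geod S p D.

Let ap_geod : geod S (fun k => a * p k) D.
Proof. exact: geod_mull. Qed.

Let p_height k : k <= D -> d 1 (p k) = k.
Proof. by move=> kD; rewrite -p0 (geodP pg) ?subn0. Qed.

Let ap_height k : k <= D -> d a (a * p k) = k.
Proof. by move=> kD; rewrite -[X in d X _]mulg1 dist_mull p_height. Qed.

(** Both [a * g] and [a^-1 * g] conjugate [a] into [H i0], so neither is relatively shorter than
    [D]; routes through [p k] and [a * p l] bound their lengths from above. In effect [k] and [l]
    differ by at most the distance of these two vertices. *)
Lemma height_diff k l : k <= D -> l <= D ->
  D <= k + d (p k) (a * p l) + (D - l) /\ D <= l + d (p k) (a * p l) + (D - k).
Proof.
move=> kD lD; have Haag : H i0 (a ^ (a * g)).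
  by rewrite conjgM (_ : a ^ a = a) // conjgE mulKg.
have HaVg : H i0 (a ^ (a^-1 * g)).
  by rewrite conjgM (_ : a ^ a^-1 = a) // conjgE invgK mulgV mulg1.
have := geodP pg kD (leqnn _); have := geodP ap_geod lD (leqnn _); rewrite pD.
have dVg : d 1 (a^-1 * g) = d a g by rewrite -(dist_mull S a) mulg1 mulVKg.
have := minD Haag; have := minD HaVg; rewrite dVg.
have := triS (p k) 1 (a * g); have := triS (a * p l) (p k) (a * g).
have := triS (a * p l) a g; have := triS (p k) (a * p l) g.
rewrite p_height // ap_height // [d (a * p l) (p k)]dist_sym //; lia.
Qed.

(** Distances across the coset force [k = l] by [height_diff]; then [p k], shorter than [g],
    conjugates [a] into [H j]. *)
Lemma no_shared_coset j h k l : k < D -> l < D ->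
  coset j h (p k) -> coset j h (p k.+1) ->
  coset j h (a * p l) -> ~ coset j h (a * p l.+1).
Proof.
move=> kD lD pk pk1 apl apl1.
have := height_diff (ltnW kD) lD; have := height_diff kD (ltnW lD).
have := coset_diam pk apl1; have := coset_diam pk1 apl => d1 d2 [_ d3] [d4 _].
have kl : k = l by lia.
have /minD : H j (a ^ p k) by rewrite conjgE; apply: coset_mem pk _; rewrite kl.
by rewrite p_height //; lia.
Qed.

Lemma axis_edge : d g (a * g) <= 1.
Proof. by apply: (dist_coset X (i := i0)); rewrite -conjgE. Qed.

Lemma axis_edge_avoids j h k : k < D -> coset j h (p k) ->
  ~ (coset j h g /\ coset j h (a * g)).
Proof.
move=> kD hk [hg hag].
have /minD : H j (a ^ p k).
  rewrite conjgE; apply: (coset_mem hk).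
  apply: coset_memr hag _; rewrite invgM -mulgA mulKg.
  exact: coset_mem hg hk.
by rewrite p_height //; lia.
Qed.

(** The quadrilateral [1], [a], [a * g], [g] is cut from [a] to [g]. The margins keep [p k] away
    from the sides [1] to [a] and [g] to [a * g], so it is [2 * delta]-close to some [a * p l], and
    [height_diff] replaces [l] by [k] at the cost of another [2 * delta]. *)
Lemma axis_fellow k : d 1 a + 2 * delta < k -> k + 2 * delta + 1 < D ->
  d (p k) (a * p k) <= 4 * delta.
Proof.
move=> k1 k2; have kD : k <= D by lia.
have d1k := p_height kD; have dkg := geodP pg kD (leqnn _); rewrite pD in dkg.
have d1g := p_height (leqnn D); rewrite pD in d1g.
have [h [h0 hn hg]] := geod_exists genS 1 a.
have b1 : d 1 (p k) + d (p k) g = d 1 g by lia.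
have [[m1 [m1b dm1]]|[r rn dr]] := thinS b1 hg h0 hn; last first.
  have := triS (h r) 1 (p k); have := geodP hg (leq0n r) rn.
  by rewrite h0 [d (h r) _]dist_sym //; lia.
have m1b' : d a m1 + d m1 g = d a g.
  by rewrite ![d a _]dist_sym // [d m1 g]dist_sym //; lia.
have a0 : a * p 0 = a by rewrite p0 mulg1.
have ag : a * p D = a * g by rewrite pD.
have [[m2 [m2b dm2]]|[l lD dl]] := thinS m1b' ap_geod a0 ag.
  have := triS m1 (p k) g; have := triS m2 m1 g; have := axis_edge.
  by rewrite [d m2 g]dist_sym //; lia.
have dkl : d (p k) (a * p l) <= 2 * delta by have := triS m1 (p k) (a * p l); lia.
have := height_diff kD lD; have := triS (a * p l) (p k) (a * p k).
case: (leqP k l) => kl; have := ap_geod; move/geodP.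
  by move=> /(_ _ _ kl lD); rewrite [d (a * p l) _]dist_sym //; lia.
by move=> /(_ _ _ (ltnW kl) kD); lia.
Qed.

Local Notation C1 := image_bound.

(** At most one edge of [p] and its translate together lies in the coset. If none occurs from [k]
    on, the projection is followed to [g], across to [a * g] and back; otherwise to [1], over to [a]
    and back. The margins on [k] keep these crossings out of the coset. *)
Lemma fellow_coset_bounded j h k s x x' :
  coset j h s -> d (p k) s <= 4 * delta ->
  d 1 a + 1 < k -> k + 4 * delta + 1 < D ->
  nearest (coset j h) (p k) x -> nearest (coset j h) (a * p k) x' ->
  dX x x' <= 3 * C1 + C.
Proof.
set B := coset j h => Bs dks k1 k2 xk xk'; have kD : k < D by lia.
pose P l := B (p l) /\ B (p l.+1); pose Q l := B (a * p l) /\ B (a * p l.+1).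
have PQ l l' : l < D -> l' < D -> P l -> ~ Q l'.
  by move=> lD l'D [Pl Pl1] [Ql]; exact: no_shared_coset Pl Pl1 Ql.
have PP l l' : l < l' -> l' < D -> P l -> ~ P l'.
  by move=> ll' l'D [Pl _] [_ Pl1]; have := coset_geod pg _ _ Pl Pl1; lia.
have QQ l l' : l < l' -> l' < D -> Q l -> ~ Q l'.
  by move=> ll' l'D [Ql _] [_ Ql1]; have := coset_geod ap_geod _ _ Ql Ql1; lia.
have gk := geod_sub pg (ltnW kD) (leqnn D).
have agk := geod_sub ap_geod (ltnW kD) (leqnn D).
have xk0 : nearest B (p (k + 0)) x by rewrite addn0.
have xk0' : nearest B (a * p (k + 0)) x' by rewrite addn0.
have [[l [kl lD PQl]]|nPQ] :=
    pselect (exists l, [/\ k <= l, l < D & P l \/ Q l]); last first.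
  have [w wg] := nearest_coset j h g; have [w' wg'] := nearest_coset j h (a * g).
  have xw : dX x w <= C1.
    apply: (bounded_image gk) xk0 _; last by rewrite subnKC // ?pD //; exact: ltnW.
    move=> l lD Pl Pl1; apply: nPQ; exists (k + l).
    by split; [lia|lia|left; rewrite /P -addnS].
  have xw' : dX x' w' <= C1.
    apply: (bounded_image agk) xk0' _; last by rewrite subnKC // ?pD //; exact: ltnW.
    move=> l lD Pl Pl1; apply: nPQ; exists (k + l).
    by split; [lia|lia|right; rewrite /Q -addnS].
  have ww' : dX w w' <= C.
    apply: nearest_edge axis_edge _ wg wg' => -[Bg _].
    have := geodP pg (ltnW kD) (leqnn D); rewrite pD.
    by have := triS s (p k) g; have := coset_diam Bs Bg; lia.
  have := triX w x x'; have := triX w' w x'; rewrite [dX w' x']dist_sym //; lia.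
have [h' [h0 hn hg]] := geod_exists genS 1 a.
have [w wg] := nearest_coset j h 1; have [w' wg'] := nearest_coset j h a.
have w0 : nearest B (p 0) w by rewrite p0.
have w0' : nearest B (a * p 0) w' by rewrite p0 mulg1.
have xw : dX w x <= C1.
  apply: (bounded_image (f := p) (n := k)) w0 xk.
    by move=> r r' r'k; apply: pg; lia.
  move=> r rk Pr Pr1; have rD : r < D by lia.
  case: PQl => [|/(PQ _ _ rD lD)]; last by apply.
  by apply: (PP r) => //; lia.
have xw' : dX w' x' <= C1.
  apply: (bounded_image (f := fun k => a * p k) (n := k)) w0' xk'.
    by move=> r r' r'k; apply: ap_geod; lia.
  move=> r rk Pr Pr1; have rD : r < D by lia.
  case: PQl => [/(PQ _ _ lD rD)|]; first by apply.
  by apply: (QQ r) => //; lia.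
have ww' : dX w w' <= C1.
  apply: (bounded_image (i := j) (g := h) hg); rewrite ?h0 ?hn // => r rn Br _.
  have := geodP hg (leq0n r) (ltnW rn); rewrite h0 => d1r.
  have := geodP hg (ltnW rn) (leqnn _); rewrite hn => dra.
  case: PQl => -[Bl _]; have := coset_diam Br Bl.
    by have := triS (h' r) 1 (p l); rewrite p_height ?(ltnW lD) //; lia.
  have := triS (h' r) a (a * p l); rewrite ap_height ?(ltnW lD) //.
  by rewrite [d a (h' r)]dist_sym //; lia.
have := triX w x x'; have := triX w' w x'; rewrite [dX x w]dist_sym //; lia.
Qed.

Definition fellow_bound := (4 * delta * (5 * image_bound + C + 1))%N.

(** A geodesic from [p k] to [a * p k] has at most [4 * delta] edges. Around an edge in a coset, the
    rest of the geodesic has no edge there, so the ends of the edge are within [image_bound] of the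
    projections of [p k] and [a * p k]. *)
Lemma axis_fellow_word k : d 1 a + 2 * delta + 1 < k -> k + 4 * delta + 1 < D ->
  dX (p k) (a * p k) <= fellow_bound.
Proof.
move=> k1 k2; have dk : d (p k) (a * p k) <= 4 * delta by apply: axis_fellow; lia.
have [h [h0 hn hg]] := geod_exists genS (p k) (a * p k).
rewrite -[X in dX X _]h0 -[X in dX _ X]hn.
apply: (@leq_trans (d (p k) (a * p k) * (5 * image_bound + C + 1))%N); last first.
  by rewrite leq_mul2r dk orbT.
apply: dist_path => l ln; have [|[j Hj]] := edge_cases (geod_lip hg ln); first by lia.
set B := coset j (h l); have Bl : B (h l) by exact: coset_refl.
have Bl1 : B (h l.+1) by exact: Hj.
have [x xk] := nearest_coset j (h l) (p k).
have [x' xk'] := nearest_coset j (h l) (a * p k).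
have xx' : dX x x' <= 3 * image_bound + C.
  apply: fellow_coset_bounded Bl _ _ _ xk xk'; try lia.
  by have := geodP hg (leq0n l) (ltnW ln); rewrite h0; lia.
have xl : dX x (h l) <= image_bound.
  apply: (bounded_image (i := j) (g := h l) (f := h) (n := l)).
  - by move=> r r' r'l; apply: hg; lia.
  - move=> r rl Br _; have := coset_geod hg _ _ Br Bl1; lia.
  - by rewrite h0.
  - exact: nearest_refl.
have xl' : dX (h l.+1) x' <= image_bound.
  apply: (bounded_image (i := j) (g := h l) (geod_sub hg ln (leqnn _))).
  - move=> r rl _ Br; have := coset_geod hg _ _ Bl Br; lia.
  - by rewrite addn0; exact: nearest_refl.
  - by rewrite subnKC ?hn.
have := triX x (h l) (h l.+1); have := triX x' x (h l.+1).
by rewrite [dX (h l) x]dist_sym // [dX x' _]dist_sym //; lia.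
Qed.

(* A repetition [a ^ p k = a ^ p l] would let one cut the segment from [p k] to
   [p l] out of the minimal conjugator [g]. *)
Lemma axis_length (bs : seq G) :
  (forall x, word_length X x <= fellow_bound -> x \in bs) ->
  D <= d 1 a + (6 * delta + size bs + 5).
Proof.
move=> bsP; rewrite leqNgt; apply/negP => bigD.
have [k0 k0E] : exists k0, k0 = d 1 a + 2 * delta + 2 by eexists.
pose s := [seq a ^ p (k0 + t) | t <- iota 0 (size bs).+1].
have s_bs : {subset s <= bs}.
  move=> _ /mapP[t /[!mem_iota] tbs ->]; apply: bsP.
  have -> : word_length X (a ^ p (k0 + t)) = dX (p (k0 + t)) (a * p (k0 + t)).
    by rewrite conjgE.
  by apply: axis_fellow_word; lia.
have : ~~ uniq s.
  by apply/negP => /uniq_leq_size /(_ s_bs); rewrite size_map size_iota ltnn.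
move=> /(uniqPn 1)[t [t' [tt']]]; rewrite size_map size_iota => t'bs.
have tbs := ltn_trans tt' t'bs.
rewrite !(nth_map 0) ?size_iota // !nth_iota // !add0n => eq_a.
have [lD kl] : k0 + t' < D /\ k0 + t < k0 + t' by lia.
move: (k0 + t) (k0 + t') lD kl eq_a => k l lD kl eq_a.
have /minD : H i0 (a ^ (p k * ((p l)^-1 * g))).
  by rewrite conjgM eq_a -conjgM mulVKg.
have : d 1 (p k * ((p l)^-1 * g)) <= d 1 (p k) + d (p l) g.
  apply: leq_trans (triS (p k) _ _) _; rewrite leq_add2l.
  by rewrite -[X in d X _]mulg1 dist_mull -(dist_mull S (p l)) mulg1 mulVKg.
have := geodP pg (ltnW lD) (leqnn _); rewrite pD p_height; lia.
Qed.

(** * Projections of [1] and [a] to the components of [p] *)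

Section Components.
Variables (j : I) (k : nat).
Hypothesis kD : k < D.
Hypothesis Hk : H j ((p k)^-1 * p k.+1).
Local Notation B := (coset j (p k)).

Let Bk : B (p k). Proof. exact: coset_refl. Qed.
Let Bk1 : B (p k.+1). Proof. exact: Hk. Qed.

Lemma entry_nearest x : nearest B 1 x -> dX x (p k) <= image_bound.
Proof.
move=> x1; apply: (bounded_image (f := p) (n := k)) (nearest_refl Bk); last first.
- by rewrite p0.
- by move=> r rk Br _; have := coset_geod pg _ _ Br Bk1; lia.
- by move=> r r' r'k; apply: pg; lia.
Qed.

(** The route from [a] along the translate of [p] to [a * g], over to [g] and back along [p] to
    [p k.+1] has no edge in the coset. *)
Lemma exit_nearest x : nearest B a x -> dX x (p k.+1) <= 2 * image_bound + C.
Proof.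
move=> xa; have [w wg] := nearest_coset j (p k) g.
have [w' wg'] := nearest_coset j (p k) (a * g).
have wk : dX (p k.+1) w <= image_bound.
  apply: (bounded_image (i := j) (g := p k) (geod_sub pg kD (leqnn D))).
  - by move=> r rD _ Br; have := coset_geod pg _ _ Bk Br; lia.
  - by rewrite addn0; exact: nearest_refl.
  - by rewrite subnKC ?pD.
have ww' : dX w w' <= C.
  by apply: nearest_edge axis_edge _ wg wg'; apply: axis_edge_avoids kD Bk.
have w'x : dX x w' <= image_bound.
  apply: (bounded_image (i := j) (g := p k) ap_geod).
  - by move=> r rD; exact: no_shared_coset Bk Bk1.
  - by rewrite p0 mulg1.
  - by rewrite pD.
have := triX w' x (p k.+1); have := triX w w' (p k.+1).
by rewrite [dX w' w]dist_sym // [dX w (p _)]dist_sym //; lia.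
Qed.

End Components.

Definition near_bound := 2 * image_bound + C.

(* A vertex whose projection to one component is far from the exit point of that
   component is seen by all later components through that exit point. *)
Lemma behrstock k k' j j' v x x' : k < k' -> k' < D ->
  H j ((p k)^-1 * p k.+1) -> H j' ((p k')^-1 * p k'.+1) ->
  nearest (coset j (p k)) v x -> nearest (coset j' (p k')) v x' ->
  dX x (p k.+1) <= near_bound \/ dX x' (p k') <= near_bound.
Proof.
rewrite /near_bound => kk' k'D Hk Hk' xv xv'.
set B := coset j (p k) in xv *; set B' := coset j' (p k') in xv' *.
have Bk : B (p k) by exact: coset_refl.
have Bk1 : B (p k.+1) by exact: Hk.
have Bk' : B' (p k') by exact: coset_refl.
have Bk1' : B' (p k'.+1) by exact: Hk'.
have BB' : B <> B'.
  move=> BB'; have := Bk1'; rewrite -BB' => Bk'1.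
  by have := coset_geod pg _ _ Bk Bk'1; lia.
have gkk' := geod_sub pg kk' (ltnW k'D).
have [f [f0 fn fg]] := geod_exists genS v x'.
(* If the geodesic to [x'] avoids the earlier coset, then [v], [x'] and [p k'] all project there
   near the exit [p k.+1]. Otherwise it meets that coset, which as a whole projects near the entry
   [p k'] of the later one. *)
have [fB|] := pselect (avoids f (d v x') B).
  left; have [y yx'] := nearest_coset j (p k) x'.
  have [z zk'] := nearest_coset j (p k) (p k').
  have xy : dX x y <= image_bound.
    by apply: (bounded_image (i := j) (g := p k) fg); rewrite ?f0 ?fn.
  have yz : dX y z <= C.
    exact: nearest_same_coset BB' xv'.1 Bk' yx' zk'.
  have kz : dX (p k.+1) z <= image_bound.
    apply: (bounded_image (i := j) (g := p k) gkk').
    - by move=> r rD _ Br; have := coset_geod pg _ _ Bk Br; lia.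
    - by rewrite addn0; exact: nearest_refl.
    - by rewrite subnKC.
  have := triX y x (p k.+1); have := triX z y (p k.+1).
  by rewrite [dX z (p _)]dist_sym //; lia.
move=> /existsNP[r] /not_implyP[rn] /not_implyP[Br _]; right.
have x'r : nearest B' (f r) x'.
  apply: nearest_between xv' _.
  have := geodP fg (leq0n r) (ltnW rn); have := geodP fg (ltnW rn) (leqnn _).
  by rewrite f0 fn; lia.
have [y yk] := nearest_coset j' (p k') (p k.+1).
have x'y : dX x' y <= C.
  by apply: nearest_same_coset (nesym BB') Br Bk1 x'r yk.
have yk' : dX y (p k') <= image_bound.
  apply: (bounded_image (i := j') (g := p k') gkk').
  - by move=> s sk Bs _; have := coset_geod pg _ _ Bs Bk1'; lia.
  - by rewrite addn0.
  - by rewrite subnKC //; exact: nearest_refl.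
by have := triX y x' (p k'); lia.
Qed.

(** While the sequence stays more than [E] away from [Q], its distance from [P] exceeds [E] by at
    most [c] per counted time; the extra 1 pays for the step that arrives near [Q]. *)
Lemma transit_count (x : nat -> G) (L c E : nat) (P Q : G) :
  (forall t, t < L -> dX (x t) (x t.+1) <= c) ->
  dX (x 0) P <= E -> dX (x L) Q <= E ->
  dX P Q <= 2 * E + c * (1 + \sum_(0 <= t < L.+1) ((E < dX (x t) P) && (E < dX (x t) Q))).
Proof.
move=> step xP xQ; rewrite leqNgt; apply/negP => far.
pose N n := \sum_(0 <= t < n) ((E < dX (x t) P) && (E < dX (x t) Q)).
have N_le l n : l <= n -> N l <= N n.
  by move=> ln; rewrite /N (big_cat_nat (leq0n l) ln) leq_addr.
have dPQ t : dX P Q <= dX (x t) P + dX (x t) Q.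
  by rewrite [dX _ P]dist_sym //; exact: triX.
have main t : t <= L -> dX (x t) P <= E + c * N t.+1.
  elim: t => [|t IHt] tL; first by lia.
  have {}IHt := IHt (ltnW tL); have := step t tL.
  have := triX (x t) (x t.+1) P; rewrite [dX (x t.+1) (x t)]dist_sym //.
  have : c * N t.+1 <= c * N L.+1 by rewrite leq_mul2l N_le ?orbT //; lia.
  have NS : N t.+2 = N t.+1 + ((E < dX (x t.+1) P) && (E < dX (x t.+1) Q)).
    by rewrite /N big_nat_recr.
  rewrite -/(N _) in far; have := dPQ t.+1; rewrite NS.
  by case: (ltnP E (dX (x t.+1) P)); case: (ltnP E (dX (x t.+1) Q)) => /=; nia.
have := main L (leqnn _); have := dPQ L; rewrite -/(N _) in far; lia.
Qed.

Definition conjugator_factor N :=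
  ((6 * delta + N + 6) * (2 * near_bound + C.+1) + C.+1)%N.

Lemma sum_disjoint (T : nat -> bool) N :
  (forall k l, k < l -> l < N -> T k -> ~~ T l) -> \sum_(0 <= k < N) T k <= 1.
Proof.
elim: N => [|N IHN] disj; first by rewrite big_nil.
rewrite big_nat_recr //=; case TN: (T N); last first.
  by rewrite addn0; apply: IHN => k l kl lN; apply: disj; lia.
rewrite big1_seq // => k /andP[_]; rewrite mem_index_iota /= => kN.
by case Tk: (T k) => //; have := disj k N kN (ltnSn N) Tk; rewrite TN.
Qed.

(** Double counting over the edges of [p] and the vertices of an [X]-geodesic from [1] to [a]: a
    long edge in a coset has many vertices projecting far from both its ends, but by [behrstock]
    each vertex does so for at most one edge. Finally [axis_length] bounds the number of edges. *)
Lemma conjugator_length (bs : seq G) :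
  (forall x, word_length X x <= fellow_bound -> x \in bs) ->
  dX 1 g <= (conjugator_factor (size bs) * (dX 1 a + 1))%N.
Proof.
move=> bsP; set L := dX 1 a.
have [v [v0 vL vg]] := geod_exists genX 1 a; rewrite -/L in vL vg.
have DL : D <= L + (6 * delta + size bs + 5).
  by apply: leq_trans (axis_length bsP) _; rewrite leq_add2r; exact: dist_relative_le.
(* The vertex [v t] is in transit across edge [k]. The index [j] is existential, as one edge may lie
   in cosets of several subgroups. *)
pose T k t := `[< exists j x, [/\ H j ((p k)^-1 * p k.+1),
  nearest (coset j (p k)) (v t) x, near_bound < dX x (p k) &
  near_bound < dX x (p k.+1)] >].
have T1 t : \sum_(0 <= k < D) T k t <= 1.
  apply: sum_disjoint => k k' kk' k'D /asboolP[j [x [Hk xv _ xk1]]].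
  apply/negP => /asboolP[j' [x' [Hk' xv' xk' _]]].
  by have [] := behrstock kk' k'D Hk Hk' xv xv'; lia.
have edge k : k < D -> dX (p k) (p k.+1) <=
    2 * near_bound + C.+1 * (1 + \sum_(0 <= t < L.+1) T k t).
  move=> kD; have [|[j Hk]] := edge_cases (geod_lip pg kD); first by nia.
  have [x xv] := choice (fun t => nearest_coset j (p k) (v t)).
  apply: leq_trans
    (transit_count (x := x) (L := L) (c := C.+1) (E := near_bound) _ _ _) _.
  - by move=> t tL; apply: nearest_step (xv t) (xv t.+1); rewrite vg //; lia.
  - apply: leq_trans (entry_nearest kD Hk _) _; last by rewrite /near_bound; lia.
    by rewrite -v0; exact: xv.
  - by apply: exit_nearest kD Hk _ _; rewrite -vL; exact: xv.
  rewrite leq_add2l leq_mul2l leq_add2l; apply/orP; right.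
  apply: leq_sum => t _; case: andP => // -[x1 x2].
  by rewrite (_ : T k t) //; apply/asboolP; exists j, (x t).
have sum_edge n : n <= D -> dX 1 (p n) <= \sum_(0 <= k < n) dX (p k) (p k.+1).
  elim: n => [|n IHn] nD; first by rewrite p0 dist_xx.
  rewrite big_nat_recr //=; have := IHn (ltnW nD).
  by have := triX (p n) 1 (p n.+1); lia.
have := sum_edge D (leqnn D); rewrite pD => /leq_trans; apply.
apply: (@leq_trans (\sum_(0 <= k < D)
    (2 * near_bound + C.+1 * (1 + \sum_(0 <= t < L.+1) T k t))%N)).
  by rewrite !big_nat; apply: leq_sum => k /andP[_ kD]; exact: edge.
rewrite big_split /= sum_nat_const_nat -big_distrr /= big_split /= sum_nat_const_nat.
rewrite exchange_big /=.
have : \sum_(0 <= t < L.+1) \sum_(0 <= k < D) T k t <= L.+1.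
  apply: (@leq_trans (\sum_(0 <= t < L.+1) 1%N)); first exact: leq_sum.
  by rewrite sum_nat_const_nat; lia.
rewrite /conjugator_factor; nia.
Qed.

End MinimalConjugator.

End Projections.

(** * Conjugacy of parabolic elements *)

Lemma uniform_bound (T : eqType) (s : seq T) (P : T -> nat -> Prop) :
  (forall x m n, m <= n -> P x m -> P x n) ->
  (forall x, x \in s -> exists n, P x n) -> exists n, forall x, x \in s -> P x n.
Proof.
move=> monoP; elim: s => [|x s IHs] exP; first by exists 0.
have [n nP] := exP x (mem_head _ _).
have [y ys|m mP] := IHs; first by apply: exP; rewrite inE ys orbT.
exists (maxn n m) => y /[!inE]/predU1P[->|/mP my].
  exact: monoP (leq_maxl _ _) nP.
exact: monoP (leq_maxr _ _) my.
Qed.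

(** * Finite balls and change of generators *)

Section Balls.
Local Open Scope group_scope.
Local Open Scope classical_set_scope.
Variables (G : groupType).
Implicit Types (S K : set G) (g h x y z : G) (m n : nat).

Lemma word_in_subgroup S K h n : is_subgroup K -> S `<=` K -> has_word S h n -> K h.
Proof.
move=> [K1 KV] SK [w [Sw <- _]].
have KI x : K x -> K x^-1 by move=> Kx; rewrite -[x^-1]mul1g; exact: KV.
elim: w Sw => [|x w IHw] Sw; first by rewrite /word_prod big_nil.
rewrite /word_prod big_cons -[\prod_(y <- w) y]invgK; apply: KV.
  by have [/SK//|/SK/KI] := Sw x (mem_head _ _); rewrite invgK.
by apply/KI/IHw => y yw; apply: Sw; rewrite inE yw orbT.
Qed.

Lemma word_length_subst S S' K h n N : is_subgroup K -> generates S' K ->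
  (forall x, S x -> K x /\ word_length S' x <= N) ->
  has_word S h n -> K h /\ word_length S' h <= (n * N)%N.
Proof.
move=> [K1 KV] genS' SN [w [Sw <- <-]].
have KI x : K x -> K x^-1 by move=> Kx; rewrite -[x^-1]mul1g; exact: KV.
elim: w Sw => [|x w IHw] Sw.
  by rewrite /word_prod big_nil word_length1.
have [|Kw wN] := IHw _; first by move=> y yw; apply: Sw; rewrite inE yw orbT.
have [Kx xN] : K x /\ word_length S' x <= N.
  have [/SN//|/SN[KVx VxN]] := Sw x (mem_head _ _).
  rewrite -[x]invgK; split; first exact: KI.
  by apply: leq_trans VxN; apply/word_length_le/has_wordV/(word_lengthP genS' KVx).
rewrite /word_prod big_cons; split.
  by rewrite -[\prod_(y <- w) y]invgK; apply: KV => //; exact: KI.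
apply: leq_trans (word_lengthM genS' Kx Kw) _.
by rewrite /= mulSn leq_add.
Qed.

Lemma word_lengthV S g : generates S setT -> word_length S g^-1 <= word_length S g.
Proof.
by move=> genS; apply/word_length_le/has_wordV; apply: word_lengthP genS _.
Qed.

Lemma ball_enum S n : finite_set S -> generates S setT ->
  exists bs : seq G, forall x, word_length S x <= n -> x \in bs.
Proof.
move=> /finite_seqP[s sS] genS.
suff [bs bsP] : exists bs : seq G, forall x m, m <= n -> has_word S x m -> x \in bs.
  by exists bs => x xn; apply: bsP xn _; apply: word_lengthP genS _.
elim: n => [|n [bs bsP]].
  exists [:: 1] => x m; rewrite leqn0 => /eqP-> [w [_ <- /size0nil->]].
  by rewrite /word_prod big_nil mem_head.
pose letters := s ++ [seq y^-1 | y <- s].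
exists (bs ++ [seq x * y | x <- bs, y <- letters]) => x m; rewrite mem_cat leq_eqVlt.
case/predU1P=> [->|mn]; last by move=> /(bsP _ _ mn) ->.
rewrite -addn1 => /word_length_prefix[y [yn [w [Sw wE]]]].
case: w Sw wE => [|z [|? ?]] // Sw; rewrite /word_prod big_seq1 => zE _.
apply/orP; right; apply/allpairsP; exists (y, z) => /=; split.
- exact: bsP yn.
- rewrite mem_cat; have [|] := Sw z (mem_head _ _); rewrite sS /= => zs.
    by rewrite zs.
  by apply/orP; right; apply/mapP; exists z^-1; rewrite ?invgK.
- by rewrite zE mulVKg.
Qed.

End Balls.

Lemma leq_expl m n e : m <= n -> m ^ e <= n ^ e.
Proof. by case: e => // e mn; rewrite leq_exp2r. Qed.

Lemma poly_nat_bound (R : realType) (P : {poly R}) n : size P <= n.+1 ->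
  exists A : nat, forall L : nat, (P.[L%:R] <= (A * L.+1 ^ n)%:R)%R.
Proof.
move=> sP; pose c := (\sum_(i < size P) `|P`_i|)%R.
exists (Num.bound c) => L; rewrite horner_coef natrM.
apply: (@le_trans _ _ (c * (L.+1 ^ n)%:R)%R); last first.
  by rewrite ler_wpM2r // ltW // archi_boundP // sumr_ge0.
rewrite /c mulr_suml; apply: ler_sum => i _.
apply: le_trans (ler_norm _) _; rewrite normrM ler_wpM2l // normrX normr_nat -natrX.
rewrite ler_nat (leq_trans (leq_expl i (leqnSn L))) // leq_pexp2l //.
by rewrite -ltnS (leq_trans (ltn_ord i)).
Qed.

(** * The conjugacy search problem inside peripheral subgroups *)

Section Conjugacy.
Local Open Scope group_scope.
Local Open Scope classical_set_scope.
Variables (G : groupType) (X : set G) (I : Type) (H : I -> set G).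
Hypothesis finX : finite_set X.
Hypothesis genX : generates X setT.
Hypothesis subgrpH : forall i, is_subgroup (H i).
Variable C : nat.
Hypothesis bcpC : first_edge_bounded X H C.
Implicit Types (a b g h x y z : G) (m n : nat) (i j : I).

Local Notation dX := (cayley_dist X).
Local Notation len := (word_length X).

Lemma dist1 x : dX 1 x = len x.
Proof. by rewrite /cayley_dist invg1 mul1g. Qed.

Lemma lenM x y : len (x * y) <= len x + len y.
Proof. exact: (word_lengthM genX). Qed.

Lemma lenV x : len x^-1 = len x.
Proof.
by apply/eqP; rewrite eqn_leq word_lengthV // -[X in _ X <= _]invgK word_lengthV.
Qed.

Lemma lenMMV x y z : len (x * (y * z^-1)) <= len x + len y + len z.
Proof.
apply: leq_trans (lenM _ _) _; rewrite -addnA leq_add2l.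
by apply: leq_trans (lenM _ _) _; rewrite lenV.
Qed.

Lemma len_conj x y : len (x ^ y) <= 2 * len y + len x.
Proof.
apply: leq_trans (lenM _ _) _; rewrite lenV mul2n -addnn -addnA leq_add2l addnC.
exact: lenM.
Qed.

(* Projecting an [X]-geodesic from 1 to [h] to the subgroup [H i] moves by
   uniformly short steps. *)
Lemma peripheral_word i h : H i h ->
  has_word [set x | H i x /\ len x <= C.+1] h (len h).
Proof.
move=> Hh; have [v [v0 vn vg]] := geod_exists genX 1 h.
rewrite dist1 in vn vg.
have A1 : coset H i 1 1 by exact: coset_refl.
suff main t : t <= len h -> forall x, nearest X H (coset H i 1) (v t) x ->
    has_word [set x | H i x /\ len x <= C.+1] x t.
  apply: main => //; rewrite vn; apply: nearest_refl.
  by rewrite /coset /= invg1 mul1g.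
elim: t => [|t IHt] tn x xt.
  rewrite v0 in xt; rewrite (nearest_self genX A1 xt); exact: has_word1.
have [y yt] := nearest_coset X subgrpH i 1 (v t).
rewrite -(mulVKg y x) -(addn1 t); apply: has_wordM; first by apply: IHt yt; exact: ltnW.
apply: has_word_letter; left; split; first exact: coset_mem yt.1 xt.1.
have vt : dX (v t) (v t.+1) <= 1 by rewrite vg //; lia.
exact: nearest_step vt yt xt.
Qed.

(* An element stabilizing two distinct peripheral cosets moves the projection of
   one to the other by a bounded amount. *)
Lemma conjugate_peripheral i j h z : H i h -> H j (h ^ z) ->
  (H i = H j /\ H i z) \/ exists2 u, H i u & len (h ^ u) <= C.
Proof.
move=> Hh Hhz; have Bz : coset H j z z by exact: coset_refl.
have [AB|AB] := pselect (coset H i 1 = coset H j z).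
  left; have Hz : coset H i 1 z by rewrite AB.
  have ABz : coset H i z = coset H j z by rewrite -(cosetE subgrpH Hz).
  split; last by move: Hz; rewrite /coset /= invg1 mul1g.
  apply/seteqP; split=> x Hx.
    have : coset H j z (z * x) by rewrite -ABz /coset /= mulKg.
    by rewrite /coset /= mulKg.
  have : coset H i z (z * x) by rewrite ABz /coset /= mulKg.
  by rewrite /coset /= mulKg.
right; have [u uz] := nearest_coset X subgrpH i 1 z.
have Hu : H i u by have := uz.1; rewrite /coset /= invg1 mul1g.
exists u => //.
have Bhz : coset H j z (h * z) by rewrite /coset /= -conjgE.
have hE : coset H i (h * 1) = coset H i 1.
  by apply/esym/cosetE => //; rewrite /coset /= invg1 mul1g mulg1.
have uhz := nearest_mull h uz; rewrite hE in uhz.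
rewrite conjgE; exact: nearest_same_coset AB Bz Bhz uz uhz.
Qed.

(** The CSP bound of [H i] in terms of the length of [G], freed from the choice of generators of
    [H i]. *)
Definition csp_factor n A i := forall h k N, H i h -> H i k ->
  (exists2 y, H i y & h ^ y = k) -> len h <= N -> len k <= N ->
  exists x, [/\ H i x, h ^ x = k & len x <= (A * N.+1 ^ n)%N].

(** By [peripheral_word], an element of [H i] is a product of as many elements of a finite ball as
    its length, so the lengths in [Y] and [X] agree on [H i] up to the factors [M1] and [M2]. *)
Lemma csp_factor_exists (R : realType) (P : {poly R}) n (bs : seq G) i :
  (size P <= n.+1)%N -> (forall x, len x <= C.+1 -> x \in bs) ->
  (exists Y : set G,
     [/\ finite_set Y, generates Y (H i) & csp_bounded (H i) Y (horner P)]) ->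
  exists A, csp_factor n A i.
Proof.
move=> /poly_nat_bound[A0 PA0] bsP [Y [/finite_seqP[ys Ys] genY cspY]].
have [M1 M1P] : exists M1, forall x, x \in bs -> H i x -> word_length Y x <= M1.
  apply: uniform_bound => [x m m' mm' xm /xm/leq_trans|x _]; first exact.
  by exists (word_length Y x).
have [M2 M2P] : exists M2, forall y, y \in ys -> len y <= M2.
  apply: uniform_bound => [x m m' mm' xm|x _]; first exact: leq_trans mm'.
  by exists (len x).
have leY h : H i h -> word_length Y h <= (len h * M1)%N.
  move=> Hh; apply: (proj2 (word_length_subst (subgrpH i) genY _ (peripheral_word Hh))).
  by move=> x [Hx xC]; split=> //; apply: M1P => //; exact: bsP.
have leX h : H i h -> len h <= (word_length Y h * M2)%N.
  move=> Hh; apply: (proj2 (word_length_subst _ genX _ (word_lengthP genY Hh))) => //.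
  by move=> y; rewrite Ys => /M2P.
exists (A0 * M1.+1 ^ n * M2)%N => h k N Hh Hk hk hN kN.
have [x [Hx hxk]] := cspY h k Hh Hk hk.
move=> /le_trans/(_ (PA0 _)); rewrite ler_nat => xle.
exists x; split=> //; apply: leq_trans (leX x Hx) _.
have Ymax : maxn (word_length Y h) (word_length Y k) <= (N * M1)%N.
  rewrite geq_max; apply/andP; split.
    by apply: leq_trans (leY h Hh) _; rewrite leq_mul2r hN orbT.
  by apply: leq_trans (leY k Hk) _; rewrite leq_mul2r kN orbT.
rewrite mulnAC leq_mul2r; apply/orP; right; apply: leq_trans xle _.
by rewrite -mulnA leq_mul2l -expnMn; apply/orP; right; apply: leq_expl; lia.
Qed.

(** The trace of [H i] on a finite ball generates [H i], hence determines it. So there are finitely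
    many subgroups, however large [I] is, and one factor per trace suffices. *)
Lemma uniform_csp (R : realType) (P : {poly R}) n :
  (size P <= n.+1)%N ->
  (forall i, exists Y : set G,
     [/\ finite_set Y, generates Y (H i) & csp_bounded (H i) Y (horner P)]) ->
  exists A, forall i, csp_factor n A i.
Proof.
move=> sP cspH; have [bs bsP] := ball_enum C.+1 finX genX.
pose e i : {ffun 'I_(size bs) -> bool} :=
  [ffun r : 'I_(size bs) => `[< H i (nth 1 bs r) >]].
have e_sub i j : e i = e j -> H i `<=` H j.
  move=> eij h /peripheral_word; apply: word_in_subgroup (subgrpH j) _ => x [Hx xC].
  have xbs := bsP x xC; have := xbs; rewrite -index_mem => xr.
  have := congr1 (fun f : {ffun _ -> bool} => f (Ordinal xr)) eij.
  by rewrite !ffunE /= nth_index // asboolT // => /esym/asboolP.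
have csp_t (t : {ffun 'I_(size bs) -> bool}) :
    exists A, forall i, e i = t -> csp_factor n A i.
  have [[i eit]|nt] := pselect (exists i, e i = t); last first.
    by exists 0 => i eit; case: nt; exists i.
  have [A cspA] := csp_factor_exists sP bsP (cspH i); exists A => j ejt.
  suff Hij : H j = H i by move=> h k N; rewrite Hij; exact: cspA.
  by apply/seteqP; split; apply: e_sub; rewrite ejt eit.
have [|t _|A AP] := @uniform_bound _ (enum {ffun 'I_(size bs) -> bool})
    (fun t A => forall i, e i = t -> csp_factor n A i).
- move=> t m m' mm' tm i /tm cspi h k N Hh Hk hk hN kN.
  have [x [Hx hxk xm]] := cspi h k N Hh Hk hk hN kN; exists x; split=> //.
  by apply: leq_trans xm _; rewrite leq_mul2r mm' orbT.
- exact: csp_t.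
- by exists A => i; apply: AP erefl; rewrite mem_enum.
Qed.

(** * Conjugators of parabolic elements *)

Variable delta : nat.
Hypothesis thinS : thin_triangles X H delta.

Local Notation S := (relative_generators X H).
Local Notation d := (cayley_dist S).

Lemma short_peripheral_conjugator :
  exists M, forall a, parabolic H a ->
    exists i g, H i (a ^ g) /\ len g <= (M * (len a + 1))%N.
Proof.
have [bs bsP] := ball_enum (fellow_bound C delta) finX genX.
exists (conjugator_factor C delta (size bs)) => a [i [h [g [Hh ahg]]]].
(* The relative length is minimised over all peripheral indices and conjugators at once, as
   [conjugator_length] demands. *)
have ex : exists D, `[< exists j g, H j (a ^ g) /\ d 1 g = D >].
  exists (d 1 g^-1); apply/asboolP; exists i, g^-1; split=> //.
  by rewrite ahg conjgK.
have /ex_minnP[D /asboolP[j [f [Hf fD]]] minD] := ex.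
exists j, f; split=> //.
have [p [p0 pD pg]] := geod_exists (gen_relative H genX) 1 f; rewrite fD in pD pg.
rewrite -!dist1; apply: (conjugator_length genX subgrpH bcpC thinS Hf _ p0 pD pg bsP).
by move=> j' g' Hg'; apply: minD; apply/asboolP; exists j', g'.
Qed.

Lemma short_conjugators_bounded N : exists W, forall h k y,
  len h <= N -> len k <= N -> h ^ y = k -> exists2 x, h ^ x = k & len x <= W.
Proof.
have [bs bsP] := ball_enum N finX genX.
have [|hk _|W WP] := @uniform_bound _ [seq (h, k) | h <- bs, k <- bs]
    (fun hk W => forall y, hk.1 ^ y = hk.2 -> exists2 x, hk.1 ^ x = hk.2 & len x <= W).
- by move=> hk m m' mm' hkm y /hkm[x xhk xm]; exists x => //; exact: leq_trans mm'.
- have [[y yhk]|nhk] := pselect (exists y, hk.1 ^ y = hk.2).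
    by exists (len y) => _ _; exists y.
  by exists 0 => y yhk; case: nhk; exists y.
- exists W => h k y /bsP hbs /bsP kbs; apply: (WP (h, k)).
  by apply/allpairsP; exists (h, k).
Qed.

Lemma parabolic_csp n A : (forall i, csp_factor n A i) ->
  exists Q, forall a b y, parabolic H a -> parabolic H b -> a ^ y = b ->
    exists2 x, a ^ x = b & len x <= (Q * (maxn (len a) (len b)).+1 ^ (2 * n + 1))%N.
Proof.
move=> cspA; have [M MP] := short_peripheral_conjugator.
have [W WP] := short_conjugators_bounded C.
pose B := (2 * M + C + 2)%N.
(* [2 * M] pays for [g] and [f], [2 * A * B ^ n] for the conjugations inside [H i] and [H j], and
   [W] for the one between short conjugates. *)
exists (2 * M + 2 * A * B ^ n + W)%N => a b y pa pb ayb.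
set L := maxn _ _; have aL : len a <= L by exact: leq_maxl.
have bL : len b <= L by exact: leq_maxr.
have [i [g [Hg gM]]] := MP a pa; have [j [f [Hf fM]]] := MP b pb.
have {}gM : len g <= (M * L.+1)%N.
  by apply: leq_trans gM _; rewrite leq_mul2l; lia.
have {}fM : len f <= (M * L.+1)%N.
  by apply: leq_trans fM _; rewrite leq_mul2l; lia.
set h := a ^ g in Hg; set k := b ^ f in Hf.
have [N BN] : exists N, N.+1 = (B * L.+1)%N.
  by exists (B * L.+1).-1; rewrite prednK // muln_gt0 /B; lia.
have NE : N.+1 = (2 * (M * L.+1) + C * L.+1 + 2 * L.+1)%N by rewrite BN /B; lia.
have CL : C <= (C * L.+1)%N by exact: leq_pmulr.
have conj_len u v : len u <= L -> len v <= (M * L.+1)%N -> len (u ^ v) <= N.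
  by move=> uL vM; have := len_conj u v; lia.
have hN : len h <= N by exact: conj_len.
have kN : len k <= N by exact: conj_len.
have CN : C <= N by lia.
pose z := g^-1 * (y * f).
have hzk : h ^ z = k by rewrite /h /k /z -!conjgM mulVKg conjgM ayb.
suff [x hxk xle] : exists2 x, h ^ x = k & len x <= (2 * A * N.+1 ^ n + W)%N.
  exists (g * (x * f^-1)).
    by rewrite conjgM -/h conjgM hxk /k conjgK.
  move: xle; rewrite BN expnMn => xle.
  set U := (L.+1 ^ (2 * n + 1))%N.
  have L1 : L.+1 <= U by rewrite -[X in X <= _]expn1 leq_pexp2l //; lia.
  have MU : M * L.+1 <= M * U by rewrite leq_mul2l L1 orbT.
  have BU : 2 * A * (B ^ n * L.+1 ^ n) <= 2 * A * B ^ n * U.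
    by rewrite mulnA leq_mul2l leq_pexp2l ?orbT //; lia.
  have WU : W <= W * U by rewrite leq_pmulr // expn_gt0.
  apply: leq_trans (lenMMV _ _ _) _.
  rewrite (mulnDl _ W) (mulnDl (2 * M)%N) -mulnA.
  move: (2 * A * B ^ n * U)%N (2 * A * (B ^ n * L.+1 ^ n))%N (W * U)%N (M * U)%N
    xle BU WU MU.
  by move=> *; lia.
have same : H i = H j -> H i z ->
    exists2 x, h ^ x = k & len x <= (2 * A * N.+1 ^ n + W)%N.
  move=> ij Hz; have Hk : H i k by rewrite ij.
  have hk : exists2 y', H i y' & h ^ y' = k by exists z.
  have [x [_ hxk xN]] := cspA i h k N Hg Hk hk hN kN.
  by exists x => //; lia.
have Hfz : H j (h ^ z) by rewrite hzk.
have [[ij Hz]|[u Hu huC]] := conjugate_peripheral Hg Hfz.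
  exact: same.
(* The same dichotomy with the roles exchanged: [z^-1] conjugates [k] back to [h]. *)
have Hgz : H i (k ^ z^-1) by rewrite -hzk conjgK.
have [[ji Hz]|[v Hv kvC]] := conjugate_peripheral Hf Hgz.
  apply: same => //; rewrite -[z]invgK; apply: subgroupV => //; rewrite -ji.
  exact: Hz.
have HJ i' x y' : H i' x -> H i' y' -> H i' (x ^ y').
  by move=> Hx Hy; rewrite conjgE; do 2?[apply: subgroupM => //]; exact: subgroupV.
have hu : exists2 y', H i y' & h ^ y' = h ^ u by exists u.
have kv : exists2 y', H j y' & k ^ y' = k ^ v by exists v.
have [x1 [_ hx1 x1N]] :=
  cspA i h (h ^ u) N Hg (HJ _ _ _ Hg Hu) hu hN (leq_trans huC CN).
have [x2 [_ kx2 x2N]] :=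
  cspA j k (k ^ v) N Hf (HJ _ _ _ Hf Hv) kv kN (leq_trans kvC CN).
have [|w hkw wW] := WP (h ^ u) (k ^ v) (u^-1 * (z * v)) huC kvC.
  by rewrite -conjgM mulVKg conjgM hzk.
exists (x1 * (w * x2^-1)).
  by rewrite !conjgM hx1 hkw -kx2 conjgK.
by apply: leq_trans (lenMMV _ _ _) _; rewrite -mulnA; lia.
Qed.

End Conjugacy.

Local Open Scope ring_scope.

Theorem theorem3p8 (R : realType) (G : groupType) (X : set G)
    (I : Type) (H : I -> set G) (n : nat) (P : {poly R}) :
  finite_set X -> generates X setT ->
  (forall i, is_subgroup (H i)) ->
  relatively_hyperbolic R X H ->
  size P = n.+1 ->
  (forall i, exists Y : set G,
     [/\ finite_set Y, generates Y (H i) & csp_bounded (H i) Y (horner P)]) ->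
  exists Q : {poly R}, size Q = (2 * n + 1).+1 /\
    forall a b : G, parabolic H a -> parabolic H b ->
      (exists y : G, (a ^ y)%g = b) ->
      exists x : G, (x^-1 * a * x)%g = b /\
        (word_length X x)%:R <=
          Q.[(maxn (word_length X a) (word_length X b))%:R].
Proof.
move=> finX genX subgrpH [rips bcp] sP cspH.
have [C bcpC] := bcp_first_edge genX subgrpH bcp.
have [delta thinS] := rips_thin genX rips.
have [A cspA] := uniform_csp finX genX subgrpH bcpC (eq_leq sP) cspH.
have [N NP] := parabolic_csp finX genX subgrpH bcpC thinS cspA.
(* [N.+1] rather than [N] keeps the leading coefficient nonzero, so the degree is exactly
   [2 * n + 1]. *)
exists ((N.+1)%:R *: ('X + 1%:P) ^+ (2 * n + 1)); split.
  rewrite size_scale ?pnatr_eq0 // -[1%:P]opprK -polyCN.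
  exact: size_exp_XsubC.
move=> a b pa pb [y ayb]; have [x axb xN] := NP a b y pa pb ayb.
exists x; split; first by rewrite -axb conjgE mulgA.
rewrite !hornerE natr1 -natrX -natrM ler_nat.
by apply: leq_trans xN _; rewrite leq_mul2r leqnSn orbT.
Qed.
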